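(* Let $\tau\in\mathbb{H}$. For all $z_1,z_2,z_3\in\mathbb{C}$ with $0<\operatorname{Im}(z_2),\operatorname{Im}(z_3)<\operatorname{Im}(\tau)$, we have $$F(z_1,z_2,z_3;\tau)= i\,\vartheta(z_1;\tau)\,\mu(z_1,z_2;\tau)\,\mu(z_1,z_3;\tau) -\frac{\eta^3(\tau)\, \vartheta(z_2+z_3;\tau)}{\vartheta(z_2;\tau)\,\vartheta(z_3;\tau)}\, \mu(z_1,z_2+z_3;\tau),$$ where the right-hand side is understood as a meromorphic function of $(z_1,z_2,z_3)$ (at points where individual factors are singular, it is interpreted by continuation).
   Context: $\mathbb{H}$ is the complex upper half-plane, $q:=e^{2\pi i\tau}$, $q^r:=e^{2\pi i r\tau}$ for rational $r$, $\zeta_j:=e^{2\pi i z_j}$, and $\zeta_j^{1/2}:=e^{\pi i z_j}$. Dedekind eta function: $\eta(\tau):=q^{1/24}\prod_{n\ge1}(1-q^n)$. Jacobi theta function: $\vartheta(z;\tau):=\sum_{n\in\frac12+\mathbb{Z}}q^{n^2/2}e^{2\pi i(z+\frac12)n}$. The $\mu$-function: for $z_1,z_2\in\mathbb{C}\setminus(\mathbb{Z}\tau+\mathbb{Z})$, $$\mu(z_1,z_2;\tau):=\frac{\zeta_1^{1/2}}{\vartheta(z_2;\tau)}\sum_{n\in\mathbb{Z}}\frac{(-\zeta_2)^nq^{n(n+1)/2}}{1-\zeta_1q^n}.$$ The indefinite theta function $F$: for $0<\operatorname{Im}(z_2),\operatorname{Im}(z_3)<\operatorname{Im}(\tau)$,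 $$F(z_1,z_2,z_3;\tau):=q^{-\frac18}\zeta_1^{-\frac12}\zeta_2^{\frac12}\zeta_3^{\frac12}\left(\sum_{k>0,\,\ell,m\geq0}+\sum_{k\leq0,\,\ell,m<0}\right)(-1)^kq^{\frac{k(k+1)}2+k\ell+km+\ell m}\zeta_1^k\zeta_2^\ell\zeta_3^m .$$ *)

(* Defs.v *)
From HB Require Import structures.
From mathcomp Require Import all_boot all_order all_algebra finmap.
From mathcomp Require Import complex.
From mathcomp Require Import all_classical all_reals all_analysis.
From mathcomp.analysis Require Import showcase.summability.

Set Implicit Arguments.
Unset Strict Implicit.
Unset Printing Implicit Defensive.

Import Order.TTheory GRing.Theory Num.Theory.
Import numFieldNormedType.Exports.

Local Open Scope classical_set_scope.
Local Open Scope ring_scope.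

(* The regular module [R[i]^o] carries the topology of the complex modulus;
   [cplx R] is a normed module over [R[i]], and so are its finite products. *)
Notation cplx R := (R[i]^o)%type.

Section Functions.
Variable R : realType.
Local Notation C := (cplx R).

Definition cexp (z : C) : C :=
  (expR (complex.Re z))%:C%C *
  (cos (complex.Im z) +i* sin (complex.Im z))%C.

Definition two_pi_i : C := 2 * (pi : R)%:C%C * 'i%C.

Definition qpow (tau : C) (r : rat) : C := cexp (two_pi_i * ratr r * tau).

Definition zeta (z : C) : C := cexp (two_pi_i * z).

Definition zeta_half (z : C) : C := cexp ((pi : R)%:C%C * 'i%C * z).

(* Unordered sum of [f] over the indices satisfying [P]: the limit of the
   finite partial sums along the directed set of finite sets of indices. *)
Definition sum_on (I : choiceType) (P : pred I) (f : I -> C) : C :=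
  summability.sum (fun i => if P i then f i else (0 : C)).

Definition dedekind_eta (tau : C) : C :=
  qpow tau (1 / 24) *
  limn (fun N : nat => \prod_(1 <= n < N.+1) (1 - qpow tau n%:R) : C).

(* The index set 1/2 + Z is parametrised by n |-> n + 1/2 with n : int. *)
Definition theta (z tau : C) : C :=
  sum_on predT (fun n : int =>
    let nu : rat := n%:Q + 1 / 2 in
    qpow tau (nu ^+ 2 / 2) * cexp (two_pi_i * (z + 1 / 2) * ratr nu)).

Definition lattice (tau : C) : set C :=
  [set w | exists m n : int, w = m%:~R * tau + n%:~R].

Definition mu (z1 z2 tau : C) : C :=
  zeta_half z1 / theta z2 tau *
  sum_on predT (fun n : int =>
    (- zeta z2) ^ n * qpow tau (n%:Q * (n%:Q + 1) / 2)
    / (1 - zeta z1 * qpow tau n%:Q)).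

Definition F_term (z1 z2 z3 tau : C) (x : int * int * int) : C :=
  let: (k, l, m) := x in
  (-1) ^ k
  * qpow tau (k%:Q * (k%:Q + 1) / 2 + k%:Q * l%:Q + k%:Q * m%:Q + l%:Q * m%:Q)
  * zeta z1 ^ k * zeta z2 ^ l * zeta z3 ^ m.

Definition F (z1 z2 z3 tau : C) : C :=
  qpow tau (- (1 / 8)) * (zeta_half z1)^-1 * zeta_half z2 * zeta_half z3 *
  (sum_on (fun x : int * int * int =>
             let: (k, l, m) := x in [&& 0 < k, 0 <= l & 0 <= m])
          (F_term z1 z2 z3 tau)
   + sum_on (fun x : int * int * int =>
               let: (k, l, m) := x in [&& k <= 0, l < 0 & m < 0])
            (F_term z1 z2 z3 tau)).

Definition F_rhs (tau : C) (z : C * C * C) : C :=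
  let: (z1, z2, z3) := z in
  'i%C * theta z1 tau * mu z1 z2 tau * mu z1 z3 tau
  - dedekind_eta tau ^+ 3 * theta (z2 + z3) tau
    / (theta z2 tau * theta z3 tau) * mu z1 (z2 + z3) tau.

(* The points at which every value of [mu] occurring in [F_rhs] is defined.
   [theta _ tau] vanishes exactly on the lattice, so no denominator of [F_rhs]
   vanishes there either. *)
Definition F_rhs_dom (tau : C) : set (C * C * C) :=
  [set z | let: (z1, z2, z3) := z in
    [/\ ~ lattice tau z1, ~ lattice tau z2, ~ lattice tau z3
      & ~ lattice tau (z2 + z3)]].

(* [v] is the value at [p] of the meromorphic function given on the dense open
   set [D] by the formula [f]: at a point of [D] it is [f p], and at a removable
   singularity it is the limit of [f] along [D]; [closure D p] makes the limit
   unique. *)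
Definition continued_value (D : set (C * C * C)) (f : C * C * C -> C)
    (p : C * C * C) (v : C) : Prop :=
  [/\ closure D p, D p -> f p = v & f w @[w --> within D (nbhs p)] --> v].

End Functions.

(* Main.v *)
Require Import Defs.
From mathcomp Require Import all_boot all_order all_algebra finmap.
From mathcomp Require Import complex.
From mathcomp Require Import all_classical all_reals all_analysis.
From mathcomp.analysis Require Import showcase.summability.
From mathcomp Require Import ring lra zify.
(** Write q = exp (2 pi i tau), let x, y, w stand for zeta_1, zeta_2, zeta_3,
    and put

      Theta(u) = sum_n (-u)^n q^(n(n+1)/2),
      A(x, u)  = sum_n (-u)^n q^(n(n+1)/2) / (1 - x q^n).

    Up to exponential factors, theta is Theta and mu (z1, z2) is A(x, y) / Theta(y).
    With S the triple sum in F, the identity to prove becomes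

      y w Theta(y) Theta(w) S = x ((q)^3 A(x, y w) + x Theta(x) A(x, y) A(x, w)),

    where (q) is the Euler product of the 1 - q^n.  Function theory is not used:
    all series converge absolutely, and the two sides are compared through
    their expansions in powers of w.

    The idea is that Theta(w) / (1 - w q^N) has no pole, because Theta vanishes at
    w = q^(-N); its Laurent coefficients T(N, j), called [quot_coef] below, are
    explicit and satisfy

      T(N + 1, j) = - q^j T(N, j - 1),
      T(N, j) - q^N T(N, j - 1) = (-1)^j q^(j(j+1)/2).

    Hence, for every family b_i with integers nu_i (under a mild decay condition),
    Theta(w) sum_i b_i / (1 - w q^(nu_i)) = sum_j w^j L(j) with
    L(j) = sum_i b_i T(nu_i, j)  ([theta_expansion]).  When b_i is a q-series with a
    simple shift rule, the two recurrences turn the shift i -> i + 1 into a linear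
    equation for L(j), which can be solved.  This is done three times.

    - For b_n = (-x)^n q^(n(n+1)/2) it gives x Theta(x) A(x, y) = y Theta(y) A(y, x)
      ([reciprocity]), which is the symmetry of mu.
    - For the same family at x = 1/q it shows that Theta(u) A(u, 1/q) does not depend
      on u ([theta_appell_opp_tau]); the constant is - (q)^3, which is the identity
      of Jacobi for eta^3 ([tail_total_eta]).  In particular Theta has no zero off
      the lattice ([theta_series_neq0]).
    - Summing S over its last index writes it as sum_i b_i / (1 - w q^(nu_i)) with i
      a pair of integers; the linear equation for L(j) then produces the
      coefficients of the right-hand side ([triple_sum_identity]).

    So F agrees with the right-hand side wherever the latter is defined
    ([F_eq_rhs]).  Since F is continuous ([F_cvg]) and that domain is dense
    ([dom_closure]), F is the continued value everywhere. *)

Set Implicit Arguments.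
Unset Strict Implicit.
Unset Printing Implicit Defensive.
Import Order.TTheory GRing.Theory Num.Theory.
Import numFieldNormedType.Exports.
Local Open Scope classical_set_scope.
Local Open Scope ring_scope.

(** * Unordered sums of complex families *)

Section UnorderedSums.
Variable R : realType.
Local Notation C := (cplx R).

(** The norm of [R[i]] takes its values in [R[i]]; the same modulus with values
    in [R] lets sizes be compared with the real exponential. *)
Definition cabs (z : C) : R := ComplexField.Normc.normc z.

Lemma normE (z : C) : `|z| = (cabs z)%:C%C.
Proof. by []. Qed.

Lemma cabs_ge0 (z : C) : 0 <= cabs z.
Proof. by rewrite -ler0c -normE. Qed.

Lemma cabsD (a b : C) : cabs (a + b) <= cabs a + cabs b.
Proof. by rewrite -lecR rmorphD /= -!normE ler_normD. Qed.

Lemma cabsM (a b : C) : cabs (a * b) = cabs a * cabs b.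
Proof. exact: ComplexField.Normc.normcM. Qed.

Lemma cabsV (a : C) : cabs a^-1 = (cabs a)^-1.
Proof. exact: ComplexField.Normc.normcV. Qed.

Lemma cabsN (a : C) : cabs (- a) = cabs a.
Proof. by apply: complexI; rewrite -!normE normrN. Qed.

Lemma cabsB (a b : C) : cabs (a - b) = cabs (b - a).
Proof. by rewrite -opprB cabsN. Qed.

Lemma cabs0 : cabs 0 = 0.
Proof. exact: ComplexField.Normc.normc0. Qed.

Lemma cabs1 : cabs 1 = 1.
Proof. exact: ComplexField.Normc.normc1. Qed.

Lemma cabs_eq0 (a : C) : (cabs a == 0) = (a == 0).
Proof.
apply/eqP/eqP => [/ComplexField.Normc.eq0_normc //|->]; exact: cabs0.
Qed.

Lemma cabs_gt0 (a : C) : (0 < cabs a) = (a != 0).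
Proof. by rewrite lt_def cabs_ge0 andbT cabs_eq0. Qed.

Lemma cabs_real (r : R) : cabs r%:C%C = `|r|.
Proof. by rewrite /cabs /= expr0n addr0 sqrtr_sqr. Qed.

Lemma cabs_sum (I : Type) (s : seq I) (f : I -> C) :
  cabs (\sum_(i <- s) f i) <= \sum_(i <- s) cabs (f i).
Proof.
elim/big_rec2: _ => [|i y x _ h]; first by rewrite cabs0.
by rewrite (le_trans (cabsD _ _)) // lerD2l.
Qed.

Lemma cabs_i : cabs ('i%C : C) = 1.
Proof. by rewrite /cabs /= expr0n add0r expr1n sqrtr1. Qed.

Lemma abs_Re_le (z : C) : `|complex.Re z| <= cabs z.
Proof. by rewrite -lecR -!normE; exact: normc_ge_Re. Qed.

Lemma abs_Im_le (z : C) : `|complex.Im z| <= cabs z.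
Proof.
rewrite -[complex.Im z]opprK -ReiNIm normrN.
apply: (le_trans (abs_Re_le _)); rewrite cabsM.
by rewrite cabs_i mulr1.
Qed.

Lemma sum_fraction_le (I : Type) (s : seq I) (e : R) : 0 <= e ->
  \sum_(i <- s) (e / (size s).+1%:R) <= e.
Proof.
move=> e0; rewrite big_const_seq count_predT iter_addr_0 -[_ *+ _]mulr_natr -mulrA.
by rewrite ler_piMr // mulrC ler_pdivrMr ?ltr0n // mul1r ler_nat.
Qed.

Lemma cvg_cabsP (W : Type) (F : set_system W) (FF : Filter F) (f : W -> C) (l : C) :
  (f w @[w --> F] --> l)%classic <->
  (forall e, 0 < e -> \forall w \near F, cabs (f w - l) < e).
Proof.
split=> [/cvgrPdist_lt h e e0|h].
  have e0' : 0 < e%:C%C :> C by rewrite ltcR.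
  by have := h _ e0'; apply: filterS => w; rewrite normE ltcR cabsB.
apply/cvgrPdist_lt => e; rewrite ltcE => /andP[/eqP/= ei er].
have := h _ er; apply: filterS => w; rewrite cabsB => hw.
rewrite normE (_ : e = (complex.Re e)%:C%C) ?ltcR //.
by case: e ei {er hw} => a b /= ->.
Qed.

Section OneIndex.
Variable I : choiceType.
Implicit Types (f : I -> C) (g : I -> R) (A B : {fset I}).

(** Convergence along the finite sets of indices, kept as a relation so that
    existence and value of a sum can be handled separately from the total
    operator [summability.sum]. *)
Definition has_sum f (s : C) := forall e : R, 0 < e ->
  exists A, forall B, (A `<=` B)%fset -> cabs (\sum_(i <- B) f i - s) < e.

(** Boundedness of the finite sums; for nonnegative families, summability. *)
Definition absum g := exists M : R, forall A, \sum_(i <- A) g i <= M.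

Lemma le_sum_subset g (s t : seq I) : (forall i, 0 <= g i) -> uniq s ->
  {subset s <= t} -> \sum_(i <- s) g i <= \sum_(i <- t) g i.
Proof.
move=> g0 us st.
have h : \sum_(i <- undup t) g i <= \sum_(i <- t) g i.
  elim: t {st} => //= i t ih; case: ifP => _; rewrite !big_cons ?lerD2l //.
  by apply: (le_trans ih); rewrite lerDr.
apply: le_trans h; rewrite [leRHS](bigID (mem s)) /= -[leLHS]addr0.
apply: lerD; last by apply: sumr_ge0.
rewrite -(big_filter (undup t)) (perm_big [seq i <- undup t | i \in s]) //.
apply: uniq_perm => //; first by rewrite filter_uniq // undup_uniq.
move=> i; rewrite mem_filter mem_undup.
by apply/idP/andP => [h|[]//]; split=> //; exact: st.
Qed.

Lemma absum_le g1 g2 : (forall i, g1 i <= g2 i) -> absum g2 -> absum g1.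
Proof.
by move=> h [M hM]; exists M => A; apply: le_trans (hM A); apply: ler_sum.
Qed.

Lemma absumZ (c : R) g : 0 <= c -> absum g -> absum (fun i => c * g i).
Proof.
move=> c0 [M hM]; exists (c * M) => A.
by rewrite -mulr_sumr ler_wpM2l.
Qed.

Lemma absumD g1 g2 : absum g1 -> absum g2 -> absum (fun i => g1 i + g2 i).
Proof.
by move=> [M hM] [N hN]; exists (M + N) => A; rewrite big_split /= lerD.
Qed.

Lemma absum_cvg g : (forall i, 0 <= g i) -> absum g ->
  exists s : R, forall e, 0 < e ->
    exists A, forall B, (A `<=` B)%fset -> s - e < \sum_(i <- B) g i <= s.
Proof.
move=> g0 [M hM].
pose E : set R := [set x | exists A, x = \sum_(i <- A) g i]%classic.
have hE : has_sup E.
  split; first by exists (\sum_(i <- fset0) g i); exists fset0.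
  by exists M => x [A ->].
exists (sup E) => e e0.
have [x [A ->] hA] := sup_adherent e0 hE; exists A => B AB; apply/andP; split.
  apply: (lt_le_trans hA); apply: le_sum_subset => //.
  by move/fsubsetP: AB.
by apply: ub_le_sup; [case: hE | exists B].
Qed.

Lemma absum_tail g : (forall i, 0 <= g i) -> absum g -> forall e, 0 < e ->
  exists A, forall B, (A `<=` B)%fset ->
    \sum_(i <- B) g i < \sum_(i <- A) g i + e.
Proof.
move=> g0 /(absum_cvg g0)[s hs] e e0; have [A hA] := hs e e0; exists A => B AB.
have /andP[h1 _] := hA A (fsubset_refl A).
have /andP[_ h2] := hA B AB; lra.
Qed.

Lemma has_sum_ext f1 f2 s : f1 =1 f2 -> has_sum f1 s -> has_sum f2 s.
Proof.
move=> h h1 e e0; have [A hA] := h1 e e0; exists A => B AB.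
by under eq_bigr do rewrite -h; exact: hA.
Qed.

Lemma has_sumD f1 f2 s1 s2 : has_sum f1 s1 -> has_sum f2 s2 ->
  has_sum (fun i => f1 i + f2 i) (s1 + s2).
Proof.
move=> h1 h2 e e0; have e2 : 0 < e / 2 by rewrite divr_gt0.
have [A1 hA1] := h1 _ e2; have [A2 hA2] := h2 _ e2.
exists (A1 `|` A2)%fset => B; rewrite fsubUset => /andP[/hA1 {}hA1 /hA2 {}hA2].
rewrite big_split /= opprD addrACA.
by apply: (le_lt_trans (cabsD _ _)); rewrite [e]splitr ltrD.
Qed.

Lemma has_sumZ (c : C) f s : has_sum f s -> has_sum (fun i => c * f i) (c * s).
Proof.
move=> h e e0; have c1 : 0 < cabs c + 1 by rewrite ltr_wpDl // cabs_ge0.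
have [A hA] := h (e / (cabs c + 1)) (divr_gt0 e0 c1); exists A => B /hA {}hA.
rewrite -mulr_sumr -mulrBr cabsM.
apply: (@le_lt_trans _ _ ((cabs c + 1) * cabs (\sum_(i <- B) f i - s))).
  by rewrite ler_wpM2r ?cabs_ge0 // lerDl.
by rewrite mulrC -ltr_pdivlMr.
Qed.

Lemma has_sumN f s : has_sum f s -> has_sum (fun i => - f i) (- s).
Proof.
by move=> /(has_sumZ (-1)); rewrite mulN1r; apply: has_sum_ext => i; rewrite mulN1r.
Qed.

Lemma has_sumB f1 f2 s1 s2 : has_sum f1 s1 -> has_sum f2 s2 ->
  has_sum (fun i => f1 i - f2 i) (s1 - s2).
Proof. by move=> h1 /has_sumN; exact: has_sumD. Qed.

Lemma has_sum_unique f s1 s2 : has_sum f s1 -> has_sum f s2 -> s1 = s2.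
Proof.
move=> h1 h2; apply/eqP; rewrite -subr_eq0 -cabs_eq0; apply/negPn/negP => n0.
have e0 : 0 < cabs (s1 - s2) / 2.
  by rewrite divr_gt0 // lt_def n0 cabs_ge0.
have [A1 hA1] := h1 _ e0; have [A2 hA2] := h2 _ e0.
have /hA1 a1 := fsubsetUl A1 A2; have /hA2 a2 := fsubsetUr A1 A2.
set S := \sum_(i <- _) _ in a1 a2.
have : cabs (s1 - s2) <= cabs (S - s1) + cabs (S - s2).
  rewrite [cabs (S - s1)]cabsB; apply: le_trans (cabsD _ _).
  by rewrite addrA subrK.
lra.
Qed.

Lemma has_sum_sum f s : has_sum f s -> summability.sum f = s.
Proof.
move=> h; have FFT := @totally_filter I; apply: cvg_lim => //.
apply/cvg_cabsP => e e0; have [A hA] := h e e0; exists A => // B /= AB.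
by have := hA B AB; rewrite /partial_sum big_seq_fsetE.
Qed.

Lemma has_sum_nneg g : (forall i, 0 <= g i) -> absum g ->
  exists s, has_sum (fun i => (g i)%:C%C : C) s.
Proof.
move=> g0 /(absum_cvg g0)[s hs]; exists (s%:C%C) => e e0.
have [A hA] := hs e e0; exists A => B /hA /andP[h1 h2].
rewrite -rmorph_sum -rmorphB cabs_real ltr_norml; apply/andP; split; lra.
Qed.

(** The real and imaginary parts become nonnegative after adding the modulus, so
    four monotone families decide convergence; this replaces completeness of the
    complex numbers. *)
Lemma absum_has_sum f : absum (fun i => cabs (f i)) -> exists s, has_sum f s.
Proof.
move=> h.
have [n hn] := has_sum_nneg (fun i => cabs_ge0 (f i)) h.
have h2 : absum (fun i => 2 * cabs (f i)) by apply: absumZ.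
have [a ha] : exists a, has_sum (fun i => (cabs (f i) + complex.Re (f i))%:C%C : C) a.
  apply: has_sum_nneg => [i|].
    by have := abs_Re_le (f i); rewrite ler_norml => /andP[]; lra.
  apply: absum_le h2 => i.
  by have := abs_Re_le (f i); rewrite ler_norml => /andP[]; lra.
have [b hb] : exists a, has_sum (fun i => (cabs (f i) + complex.Im (f i))%:C%C : C) a.
  apply: has_sum_nneg => [i|].
    by have := abs_Im_le (f i); rewrite ler_norml => /andP[]; lra.
  apply: absum_le h2 => i.
  by have := abs_Im_le (f i); rewrite ler_norml => /andP[]; lra.
exists ((a - n) + 'i%C * (b - n)).
have := has_sumD (has_sumB ha hn) (has_sumZ 'i%C (has_sumB hb hn)).
apply: has_sum_ext => i; rewrite -!rmorphB /= !(addrC (cabs _)) !addrK.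
by rewrite -complexE.
Qed.

Lemma absum_sum f :
  absum (fun i => cabs (f i)) -> has_sum f (summability.sum f).
Proof. by move=> /absum_has_sum[s hs]; rewrite (has_sum_sum hs). Qed.

Lemma has_sum_bound f s g (M : R) : (forall i, cabs (f i) <= g i) ->
  (forall A, \sum_(i <- A) g i <= M) -> has_sum f s -> cabs s <= M.
Proof.
move=> fg gM h; apply/ler_addgt0Pr => e e0.
have [A /(_ A (fsubset_refl A)) hA] := h e e0.
have -> : s = \sum_(i <- A) f i - (\sum_(i <- A) f i - s) by ring.
apply: (le_trans (cabsD _ _)); rewrite cabsN lerD //; last exact: ltW.
apply: le_trans (cabs_sum _ _) _; apply: le_trans (gM A); exact: ler_sum.
Qed.

Lemma has_sum_delta (a : I) (v : C) :
  has_sum (fun i => if i == a then v else 0) v.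
Proof.
move=> e e0; exists [fset a]%fset => B; rewrite fsub1set => aB.
rewrite (big_fsetD1 a) //= eqxx big_seq big1 ?addr0 ?subrr ?cabs0 //.
by move=> i; rewrite in_fsetD1 => /andP[/negPf ->].
Qed.

Lemma has_sum0 : has_sum (fun _ => 0) 0.
Proof. by move=> e e0; exists fset0 => B _; rewrite big1 // subrr cabs0. Qed.

(** Holds even for [c = 0], where nothing is known about [f]: this allows
    multiplying a series by a theta value before knowing that the value is
    nonzero. *)
Lemma has_sumZI (c : C) f s : has_sum (fun i => c * f i) s ->
  c * summability.sum f = s.
Proof.
have [->|c0] := eqVneq c 0 => h.
  rewrite mul0r; apply: has_sum_unique h.
  by apply: has_sum_ext has_sum0 => i; rewrite mul0r.
rewrite (@has_sum_sum f (c^-1 * s)); first by rewrite mulVKf.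
by apply: has_sum_ext (has_sumZ c^-1 h) => i; rewrite mulKf.
Qed.

End OneIndex.

Lemma absum_inj (I J : choiceType) (h : J -> I) (g : I -> R) :
  injective h -> (forall i, 0 <= g i) -> absum g -> absum (fun j => g (h j)).
Proof.
move=> hi g0 [M hM]; exists M => A.
apply: le_trans (hM [fset h x | x in A]%fset).
rewrite -(big_map h predT g).
apply: le_sum_subset => //; first by rewrite map_inj_uniq // fset_uniq.
by move=> i /mapP[j jA ->]; apply/imfsetP; exists j.
Qed.

Lemma big_fset_bij (I J : choiceType) (h : J -> I) (f : I -> C) (B : {fset J}) :
  injective h ->
  \sum_(j <- B) f (h j) = \sum_(i <- [fset h x | x in B]%fset) f i.
Proof.
move=> hi; rewrite -(big_map h predT f).
apply/perm_big/uniq_perm; rewrite ?map_inj_uniq ?fset_uniq //.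
move=> i; apply/mapP/imfsetP => -[j jB ->]; by exists j.
Qed.

Lemma has_sum_reindex (I J : choiceType) (h : J -> I) (h' : I -> J)
    (f : I -> C) s : cancel h h' -> cancel h' h ->
  has_sum f s -> has_sum (fun j => f (h j)) s.
Proof.
move=> hK h'K hs e e0; have [A hA] := hs e e0.
exists [fset h' x | x in A]%fset => B AB.
rewrite (big_fset_bij _ _ (can_inj hK)); apply: hA.
apply/fsubsetP => i iA; apply/imfsetP; exists (h' i); last by rewrite h'K.
by apply: (fsubsetP AB); apply/imfsetP; exists i.
Qed.

Section TwoIndices.
Variables I J : choiceType.

Lemma absum_prod (g : I -> R) (h : J -> R) :
  (forall i, 0 <= g i) -> (forall j, 0 <= h j) -> absum g -> absum h ->
  absum (fun p : I * J => g p.1 * h p.2).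
Proof.
move=> g0 h0 [M hM] [N hN]; exists (M * N) => A.
pose A1 := [fset p.1 | p in A]%fset; pose A2 := [fset p.2 | p in A]%fset.
apply: (@le_trans _ _ (\sum_(p <- [seq (i, j) | i <- A1, j <- A2]) g p.1 * h p.2)).
  apply: le_sum_subset => //; first by move=> p; rewrite mulr_ge0.
  move=> [i j] pA; apply/allpairsP; exists (i, j); split=> //=.
    by apply/imfsetP; exists (i, j).
  by apply/imfsetP; exists (i, j).
rewrite big_allpairs /=.
under eq_bigr do rewrite -mulr_sumr.
by rewrite -mulr_suml; apply: ler_pM => //; exact: sumr_ge0.
Qed.

(** Only one inclusion of finite sets is needed: a finite box containing a good
    finite set is good, and letting its second side grow gives the row sums. *)
Lemma has_sum_sigma (f : I * J -> C) s (r : I -> C) :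
  has_sum f s -> (forall i, has_sum (fun j => f (i, j)) (r i)) -> has_sum r s.
Proof.
move=> hf hr e e0; have e2 : 0 < e / 2 by rewrite divr_gt0.
have [A hA] := hf _ e2; exists [fset p.1 | p in A]%fset => B AB.
pose m : R := (size (enum_fset B)).+1%:R.
have m0 : 0 < m by rewrite ltr0n.
have e3 : 0 < e / 2 / m by rewrite divr_gt0.
have [K hK] : exists K : {fset J}, forall i, i \in B -> forall L : {fset J},
    (K `<=` L)%fset -> cabs (\sum_(j <- L) f (i, j) - r i) < e / 2 / m.
  have [k hk] := choice (fun i => hr i _ e3).
  exists (\bigcup_(i <- B) k i)%fset => i iB L KL; apply: hk.
  apply: fsubset_trans KL; exact: bigfcup_sup.
pose L := (K `|` [fset p.2 | p in A])%fset.
have KL : (K `<=` L)%fset by exact: fsubsetUl.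
have AL : (A `<=` B `*` L)%fset.
  apply/fsubsetP => -[i j] pA; rewrite in_fsetM; apply/andP; split=> /=.
    by apply: (fsubsetP AB); apply/imfsetP; exists (i, j).
  by rewrite in_fsetU; apply/orP; right; apply/imfsetP; exists (i, j).
have := hA _ AL.
have -> : \sum_(p <- (B `*` L)%fset) f p = \sum_(i <- B) \sum_(j <- L) f (i, j).
  rewrite -(big_allpairs (F := f)); apply: perm_big.
  apply: uniq_perm; rewrite ?fset_uniq //.
    by apply: allpairs_uniq; rewrite ?fset_uniq // => -[? ?] [? ?].
  move=> [i j]; rewrite in_fsetM; apply/andP/allpairsP => [[iB jL]|[[a b] [? ? [-> ->]]] //].
  by exists (i, j).
move=> h.
rewrite -(subrK (\sum_(i <- B) \sum_(j <- L) f (i, j)) (\sum_(i <- B) r i)) -addrA.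
apply: (le_lt_trans (cabsD _ _)); rewrite [e]splitr ler_ltD //.
rewrite -sumrB; apply: (le_trans (cabs_sum _ _)).
apply: (@le_trans _ _ (\sum_(i <- B) (e / 2 / m))).
  rewrite !big_seq; apply: ler_sum => i iB; rewrite cabsB; apply: ltW.
  exact: hK.
exact/sum_fraction_le/ltW.
Qed.

End TwoIndices.

Lemma has_sum_swap (I J : choiceType) (f : I * J -> C) s (r : J -> C) :
  has_sum f s -> (forall j, has_sum (fun i => f (i, j)) (r j)) -> has_sum r s.
Proof.
move=> hf hr; apply: (@has_sum_sigma _ _ (fun p : J * I => f (p.2, p.1))) => //.
by apply: (@has_sum_reindex _ _ (fun p : J * I => (p.2, p.1)) (fun p => (p.2, p.1))) hf => -[].
Qed.

(** Dominated convergence for families: outside a finite set the bound [g] makes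
    all sums small uniformly in [w]. *)
Lemma has_sum_dominated (W : Type) (F : set_system W) (FF : Filter F)
    (I : choiceType) (f : W -> I -> C) (f0 : I -> C) (s : W -> C) (s0 : C)
    (g : I -> R) :
  absum g ->
  (\forall w \near F, forall i, cabs (f w i) <= g i) ->
  (forall i, cabs (f0 i) <= g i) ->
  (forall i e, 0 < e -> \forall w \near F, cabs (f w i - f0 i) < e) ->
  (\forall w \near F, has_sum (f w) (s w)) -> has_sum f0 s0 ->
  forall e, 0 < e -> \forall w \near F, cabs (s w - s0) < e.
Proof.
move=> hg fg f0g ff0 hs hs0 e e0.
have g0 i : 0 <= g i by apply: le_trans (f0g i); exact: cabs_ge0.
have e4 : 0 < e / 4 by rewrite divr_gt0.
have [A hA] := absum_tail g0 hg e4.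
have tail (h : I -> C) (t : C) : (forall i, cabs (h i) <= g i) -> has_sum h t ->
    cabs (t - \sum_(i <- A) h i) <= e / 4.
  move=> hb ht; apply/ler_addgt0Pr => d d0; have [B hB] := ht _ d0.
  have := hB (B `|` A)%fset (fsubsetUl _ _).
  have AB : (A `<=` B `|` A)%fset by exact: fsubsetUr.
  have := hA _ AB.
  have split_sum (V : zmodType) (k : I -> V) : \sum_(i <- (B `|` A)%fset) k i =
      \sum_(i <- A) k i + \sum_(i <- (B `|` A)%fset | i \notin A) k i.
    rewrite (bigID (mem A)) /=; congr (_ + _).
    rewrite -big_filter; apply/perm_big/uniq_perm; rewrite ?filter_uniq ?fset_uniq //.
    move=> i; rewrite mem_filter in_fsetU; case: (i \in A) => //=; by rewrite orbT.
  rewrite !split_sum ltrD2l.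
  set T1 := \sum_(i <- (B `|` A)%fset | i \notin A) g i.
  set T2 := \sum_(i <- (B `|` A)%fset | i \notin A) h i.
  set S := \sum_(i <- A) h i.
  move=> hT1 hS.
  have hT : cabs T2 <= T1.
    rewrite /T2 /T1 -!(big_filter _ (fun i => i \notin A)).
    apply: (le_trans (cabs_sum _ _)); exact: ler_sum.
  have -> : t - S = T2 - (S + T2 - t) by ring.
  apply: (le_trans (cabsD _ _)); rewrite cabsN; lra.
pose m : R := (size (enum_fset A)).+1%:R.
have m0 : 0 < m by rewrite ltr0n.
have e3 : 0 < e / 4 / m by rewrite divr_gt0.
have fin : \forall w \near F, forall i, i \in enum_fset A ->
    cabs (f w i - f0 i) < e / 4 / m.
  elim: (enum_fset A) => [|a B ih]; first by apply: nearW.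
  have := ff0 a _ e3; move: ih; apply: filterS2 => w h1 h2 i.
  by rewrite inE => /predU1P[->|/h1].
move: fg hs fin; apply: filterS3 => w fg hs fin.
have t1 := tail _ _ fg hs; have t0 := tail _ _ f0g hs0.
have t2 : cabs (\sum_(i <- A) f w i - \sum_(i <- A) f0 i) <= e / 4.
  rewrite -sumrB; apply: (le_trans (cabs_sum _ _)).
  apply: (@le_trans _ _ (\sum_(i <- A) (e / 4 / m))).
    by rewrite !big_seq; apply: ler_sum => i iA; apply: ltW; exact: fin.
  exact/sum_fraction_le/ltW.
have -> : s w - s0 = (s w - \sum_(i <- A) f w i) +
   (\sum_(i <- A) f w i - \sum_(i <- A) f0 i) - (s0 - \sum_(i <- A) f0 i) by ring.
apply: (le_lt_trans (cabsD _ _)); rewrite cabsN.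
apply: (@le_lt_trans _ _ (e/4 + e/4 + e/4)); last lra.
by rewrite lerD // (le_trans (cabsD _ _)) // lerD.
Qed.

Lemma has_sum_finite (I : choiceType) (f : I -> C) (s : seq I) :
  uniq s -> (forall i, i \notin s -> f i = 0) -> has_sum f (\sum_(i <- s) f i).
Proof.
move=> us h e e0; exists [fset i in s]%fset => B sB.
suff -> : \sum_(i <- B) f i = \sum_(i <- s) f i by rewrite subrr cabs0.
rewrite (bigID (mem s)) /= addrC big1 ?add0r; last by move=> i /h.
rewrite -big_filter; apply: perm_big.
apply: uniq_perm; rewrite ?filter_uniq ?fset_uniq // => i.
rewrite mem_filter; case: (boolP (i \in s)) => //= is_.
by apply: (fsubsetP sB); rewrite inE.
Qed.

Lemma seq_cvg_unique (f : nat -> C) (a b : C) :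
  (f n @[n --> \oo] --> a)%classic -> (f n @[n --> \oo] --> b)%classic -> a = b.
Proof.
move=> /cvg_cabsP ha /cvg_cabsP hb.
apply/eqP; rewrite -subr_eq0 -cabs_eq0; apply/negPn/negP => n0.
have e0 : 0 < cabs (a - b) / 2 by rewrite divr_gt0 // lt_def n0 cabs_ge0.
have [N _ /(_ N (leqnn N)) [h1 h2]] := filterI (ha _ e0) (hb _ e0).
have : cabs (a - b) <= cabs (f N - a) + cabs (f N - b).
  rewrite [cabs (f N - a)]cabsB; apply: le_trans (cabsD _ _).
  by rewrite addrA subrK.
lra.
Qed.

Lemma has_sum_nat_cvg (f : nat -> C) s : has_sum f s ->
  (\sum_(i < n) f i @[n --> \oo] --> s)%classic.
Proof.
move=> hs; apply/cvg_cabsP => e e0; have [A hA] := hs e e0.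
exists (\max_(n <- A) n).+1 => // n /= hn.
have := hA [fset i in iota 0 n]%fset; rewrite -(big_mkord xpredT) /index_iota subn0.
rewrite (perm_big (iota 0 n)) /=; last first.
  by apply: uniq_perm; rewrite ?fset_uniq ?iota_uniq // => i; rewrite inE.
apply; apply/fsubsetP => i iA; rewrite inE /= mem_iota add0n /=.
by apply: leq_ltn_trans hn; apply: leq_bigmax_seq.
Qed.

Lemma cvg_Re_Im (W : Type) (F : set_system W) (FF : Filter F) (f : W -> C) (l : C) :
  (f w @[w --> F] --> l) <->
  (complex.Re (f w) @[w --> F] --> complex.Re l) /\
  (complex.Im (f w) @[w --> F] --> complex.Im l).
Proof.
have ReB (a b : C) : complex.Re (a - b) = complex.Re a - complex.Re b.
  by case: a b => ? ? [? ?].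
have ImB (a b : C) : complex.Im (a - b) = complex.Im a - complex.Im b.
  by case: a b => ? ? [? ?].
split=> [/cvg_cabsP h|[/cvgrPdist_lt hr /cvgrPdist_lt hi]].
  split; apply/cvgrPdist_lt => e e0; have := h e e0; apply: filterS => w hw.
    rewrite distrC; apply: le_lt_trans hw.
    by rewrite -ReB abs_Re_le.
  rewrite distrC; apply: le_lt_trans hw.
  by rewrite -ImB abs_Im_le.
apply/cvg_cabsP => e e0; have e2 : 0 < e / 2 by rewrite divr_gt0.
have := hi _ e2; have := hr _ e2; apply: filterS2 => w h1 h2.
have -> : f w - l = (complex.Re (f w) - complex.Re l)%:C%C +
   'i%C * (complex.Im (f w) - complex.Im l)%:C%C.
  by rewrite [LHS]complexE ReB ImB.
apply: le_lt_trans (cabsD _ _) _; rewrite cabsM !cabs_real.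
by rewrite cabs_i mul1r distrC [X in _ + X]distrC [e]splitr ltrD.
Qed.

End UnorderedSums.

Arguments cabs : simpl never.

(** * The exponential exp (2 pi i z) *)

Section Zeta.
Variable R : realType.
Local Notation C := (cplx R).

Lemma cexpD (a b : C) : cexp (a + b) = cexp a * cexp b.
Proof.
case: a b => [a1 a2] [b1 b2]; rewrite /cexp /= expRD cosD sinD.
by apply/eqP; rewrite eq_complex /=; apply/andP; split; apply/eqP; ring.
Qed.

Lemma cabs_cexp (z : C) : cabs (cexp z) = expR (complex.Re z).
Proof.
rewrite /cexp cabsM cabs_real ger0_norm ?expR_ge0 //.
by rewrite /cabs /= cos2Dsin2 sqrtr1 mulr1.
Qed.

(** [zeta] under a lock: matching modulo conversion would otherwise unfold it to
    a product of exponentials, sines and cosines.  All monomials in q and the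
    zeta_j, and all signs, are written as values of [e2pi], so that identities
    between them reduce to identities between exponents. *)
Definition e2pi (z : C) : C := locked (@zeta R) z.

Lemma e2piE (z : C) : e2pi z = zeta z.
Proof. by rewrite /e2pi -lock. Qed.

Lemma e2piD (a b : C) : e2pi (a + b) = e2pi a * e2pi b.
Proof. by rewrite !e2piE /zeta mulrDr cexpD. Qed.

Lemma Re_two_pi_i (z : C) : complex.Re (two_pi_i R * z) = - (2 * pi * complex.Im z).
Proof. case: z => a b; rewrite /two_pi_i /=; ring. Qed.

Lemma Im_two_pi_i (z : C) : complex.Im (two_pi_i R * z) = 2 * pi * complex.Re z.
Proof. case: z => a b; rewrite /two_pi_i /=; ring. Qed.

Lemma cabs_e2pi (z : C) : cabs (e2pi z) = expR (- (2 * pi * complex.Im z)).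
Proof. by rewrite e2piE /zeta cabs_cexp Re_two_pi_i. Qed.

Lemma e2pi_neq0 (z : C) : e2pi z != 0.
Proof. by rewrite -cabs_gt0 cabs_e2pi expR_gt0. Qed.

Lemma e2pi0 : e2pi (0 : C) = 1.
Proof.
apply: (mulfI (e2pi_neq0 0)); by rewrite -e2piD addr0 mulr1.
Qed.

Lemma e2piN (z : C) : e2pi (- z) = (e2pi z)^-1.
Proof.
apply: (mulfI (e2pi_neq0 z)); by rewrite -e2piD subrr e2pi0 divff ?e2pi_neq0.
Qed.

Lemma e2piB (a b : C) : e2pi (a - b) = e2pi a / e2pi b.
Proof. by rewrite e2piD e2piN. Qed.

Lemma e2pi_polar (z : C) : e2pi z = (expR (- (2 * pi * complex.Im z)))%:C%C *
  (cos (2 * pi * complex.Re z) +i* sin (2 * pi * complex.Re z))%C.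
Proof. by rewrite e2piE /zeta /cexp Re_two_pi_i Im_two_pi_i. Qed.

Lemma e2pi_1_2 : e2pi (1 / 2 : C) = -1.
Proof.
have -> : (1 / 2 : C) = ((1 / 2 : R)%:C)%C by rewrite rmorphM fmorphV rmorph1 rmorph_nat.
rewrite e2pi_polar /= mulr0 oppr0 expR0 mul1r.
rewrite (_ : 2 * pi / 2 = pi); last by field.
rewrite mul1r.
by rewrite cospi sinpi; apply/eqP; rewrite eq_complex /= oppr0 !eqxx.
Qed.

Lemma oppr_e2pi (z : C) : - e2pi z = e2pi (1 / 2 + z).
Proof. by rewrite e2piD e2pi_1_2 mulN1r. Qed.

Lemma e2pi1 : e2pi (1 : C) = 1.
Proof. by rewrite [X in e2pi X]splitr e2piD e2pi_1_2 mulrNN mulr1. Qed.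

Lemma e2pi_intM (n : int) (z : C) : e2pi (n%:~R * z) = e2pi z ^ n.
Proof.
elim/int_rect: n => [|n ih|n ih].
- by rewrite mul0r e2pi0 expr0z.
- by rewrite intS intrD mulrDl mul1r e2piD ih exprSz.
- rewrite intS opprD intrD mulrDl e2piD mulN1r e2piN ih.
  by rewrite expfzDr ?e2pi_neq0 // exprN1.
Qed.

Lemma e2pi_int (n : int) : e2pi (n%:~R : C) = 1.
Proof. by rewrite -[n%:~R]mulr1 e2pi_intM e2pi1 exp1rz. Qed.

Lemma e2pi_half_int (n : int) : e2pi (n%:~R / 2 : C) = (-1) ^ n.
Proof. by rewrite -[2^-1]mul1r e2pi_intM e2pi_1_2. Qed.

(** Reduce modulo the period to an angle in [0, 2 pi), then use injectivity of cos
    on [0, pi] for the angle or for its opposite. *)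
Lemma cos_eq1 (a : R) : cos a = 1 -> exists n : int, a = 2 * pi * n%:~R.
Proof.
move=> ha; have p0 : 0 < 2 * pi :> R by rewrite mulr_gt0 ?pi_gt0.
have pi0 := pi_gt0 R.
(* the angle modulo 2 pi is a - 2 pi n *)
exists (Num.floor (a / (2 * pi))); set n := Num.floor _.
have h1 : n%:~R <= a / (2 * pi) by exact: floor_le_tmp.
have h2 : a / (2 * pi) < n%:~R + 1 by rewrite -[1]/(1%:~R) -intrD floorD1_gt.
have cosT x : cos (x + 2 * pi) = cos x :> R by rewrite mulr_natl; exact: cosD2pi.
have cosn (m : int) (x : R) : cos (x + 2 * pi * m%:~R) = cos x.
  elim/int_rect: m x => [|m ih|m ih] x; first by rewrite mulr0 addr0.
  - rewrite intS intrD mulrDr mulr1 addrA ih.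
    exact: cosT.
  - rewrite intS opprD intrD mulrDr mulrN1 addrA ih.
    by rewrite -cosT subrK.
pose b := a - 2 * pi * n%:~R.
have hb : cos b = 1 by rewrite -ha -(cosn n b) /b subrK.
have b0 : 0 <= b by rewrite subr_ge0 mulrC -ler_pdivlMr.
have b1 : b < 2 * pi.
  move: h2; rewrite ltr_pdivrMr // mulrDl mul1r mulrC /b; lra.
suff : b = 0 by rewrite /b => /subr0_eq.
have [bp|bp] := leP b pi.
  apply: cos_inj; rewrite ?in_itv /= ?b0 ?bp ?lexx ?(ltW pi0) //.
  by rewrite hb cos0.
exfalso; have : 2 * pi - b = 0.
  apply: cos_inj; rewrite ?in_itv /= ?lexx ?(ltW pi0) //.
    by apply/andP; split; lra.
  by rewrite cos0 -cosN opprB -(cosT (b - 2 * pi)) subrK.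
lra.
Qed.

Lemma e2pi_eq1_Im (z : C) : e2pi z = 1 -> complex.Im z = 0.
Proof.
move=> h; have p0 : 2 * pi != 0 :> R by rewrite mulf_neq0 // gt_eqF // pi_gt0.
have := cabs_e2pi z; rewrite h cabs1 -[X in X = _](@expR0 R) => /expR_inj/esym/eqP.
by rewrite oppr_eq0 mulf_eq0 (negPf p0) => /eqP.
Qed.

Lemma e2pi_eq1 (z : C) : e2pi z = 1 -> exists n : int, z = n%:~R.
Proof.
move=> h; have p0 : 2 * pi != 0 :> R by rewrite mulf_neq0 // gt_eqF // pi_gt0.
have hI := e2pi_eq1_Im h; have := e2pi_polar z; rewrite h hI mulr0 oppr0 expR0 mul1r => -[/esym/cos_eq1[n hn] _].
exists n; move/(mulfI p0): hn => hn.
by case: z h hI hn => a b /= _ -> ->; rewrite complexr0 rmorph_int.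
Qed.

Lemma qpowE (tau : C) (r : rat) : qpow tau r = e2pi (ratr r * tau).
Proof. by rewrite /qpow e2piE /zeta -mulrA. Qed.

Lemma zeta_halfE (z : C) : zeta_half z = e2pi (z / 2).
Proof.
rewrite e2piE /zeta_half /zeta /two_pi_i; congr cexp.
by rewrite [in RHS]mulrC -mulrA [_ * (pi%:C)%C]mulrC; field.
Qed.

Lemma Im_realM (r : R) (z : C) : complex.Im (r%:C%C * z) = r * complex.Im z.
Proof. by case: z => a b /=; rewrite mul0r addr0. Qed.

Lemma Im_intM (n : int) (z : C) : complex.Im (n%:~R * z) = n%:~R * complex.Im z.
Proof. by rewrite -Im_realM rmorph_int. Qed.

Lemma ImD (a b : C) : complex.Im (a + b) = complex.Im a + complex.Im b.
Proof. by case: a b => ? ? [? ?]. Qed.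

Lemma ImN (a : C) : complex.Im (- a) = - complex.Im a.
Proof. by case: a. Qed.

Lemma Im_int_half (n : int) : complex.Im (n%:~R / 2 : C) = 0.
Proof.
have -> : (n%:~R / 2 : C) = ((n%:~R / 2 : R)%:C)%C.
  by rewrite rmorphM fmorphV rmorph_int rmorph_nat.
by [].
Qed.

Definition tri (K : fieldType) (n : int) : K := n%:~R * (n%:~R + 1) / 2.

Lemma Im_triM (n : int) (z : C) : complex.Im (tri C n * z) = tri R n * complex.Im z.
Proof.
rewrite -Im_realM; congr (complex.Im (_ * _)).
by rewrite /tri !rmorphM fmorphV rmorphD rmorph_int rmorph_nat rmorph1.
Qed.

End Zeta.

(** * Summable families of real exponentials *)

Section RealBounds.
Variable R : realType.

Lemma absum_int (g : int -> R) : (forall n, 0 <= g n) ->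
  absum (fun n : nat => g n%:Z) -> absum (fun n : nat => g (Negz n)) -> absum g.
Proof.
move=> g0 [M hM] [N hN]; exists (M + N) => A.
pose P1 := [fset absz n | n in A]%fset.
pose P2 := [fset (absz n).-1 | n in A]%fset.
apply: (@le_trans _ _ (\sum_(n <- map Posz P1 ++ map Negz P2) g n)).
  apply: le_sum_subset; rewrite ?fset_uniq // => n nA; rewrite mem_cat.
  apply/orP; case: n nA => m mA; [left|right]; apply/mapP; exists m => //.
    by apply/imfsetP; exists (Posz m).
  by apply/imfsetP; exists (Negz m).
by rewrite big_cat !big_map /= lerD.
Qed.

Lemma absum_geom (r : R) : 0 <= r < 1 -> absum (fun n : nat => r ^+ n).
Proof.
move=> /andP[r0 r1]; exists (1 - r)^-1 => A.
have sr : 0 < 1 - r by rewrite subr_gt0.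
apply: (@le_trans _ _ (\sum_(n <- iota 0 (\max_(n <- A) n).+1) r ^+ n)).
  apply: le_sum_subset; rewrite ?fset_uniq // => n; first exact: exprn_ge0.
  move=> nA.
  by rewrite mem_iota add0n ltnS leq0n /=; apply: leq_bigmax_seq.
set N := (X in iota 0 X); have -> : iota 0 N = index_iota 0 N.
  by rewrite /index_iota subn0.
rewrite big_mkord -[_^-1]div1r ler_pdivlMr // mulrC -opprB mulNr -subrX1 opprB.
by rewrite lerBlDr lerDl exprn_ge0.
Qed.

Lemma absum_expR_abs (d : R) : 0 < d -> absum (fun n : int => expR (- (d * `|n|%:~R))).
Proof.
move=> d0; have h : absum (fun n : nat => expR (- d) ^+ n).
  by apply: absum_geom; rewrite expR_ge0 expR_lt1 oppr_lt0.
apply: absum_int => [n||]; first exact: expR_ge0.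
  apply: absum_le h => n; rewrite -expRM_natl /=.
  by rewrite mulrN mulrC lexx.
apply: absum_le h => n; rewrite -expRM_natl ler_expR mulrN lerN2 mulrC.
by rewrite ler_wpM2l ?(ltW d0) // ler_nat.
Qed.

(** Completing the square compares the quadratic exponent with [- `|n|]. *)
Lemma absum_expR_quad (a b c : R) : 0 < a ->
  absum (fun n : int => expR (- (a * n%:~R ^+ 2) + b * n%:~R + c)).
Proof.
move=> a0; pose K := (`|b| + 1) ^+ 2 / (4 * a) + c.
have h := @absumZ R _ (expR K) _ (expR_ge0 K) (absum_expR_abs (@ltr01 R)).
apply: absum_le h => n; rewrite -expRD ler_expR mul1r /K.
have -> : `|n|%:~R = `|n%:~R| :> R by rewrite intr_norm.
set x : R := n%:~R.
have h1 : b * x <= `|b| * `|x| by rewrite -normrM ler_norm.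
have h2 : x ^+ 2 = `|x| ^+ 2 by rewrite real_normK // num_real.
rewrite h2; set y := `|x| in h1 *; set B := `|b| in h1 *.
have h3 : (B + 1) * y - a * y ^+ 2 <= (B + 1) ^+ 2 / (4 * a).
  rewrite ler_pdivlMr ?mulr_gt0 // -subr_ge0.
  rewrite (_ : _ - _ = (B + 1 - 2 * a * y) ^+ 2) ?sqr_ge0 //; ring.
lra.
Qed.

End RealBounds.

(** * Theta series and their quotients *)

Lemma subr1K : cancel (fun j : int => j - 1) (fun j => j + 1).
Proof. by move=> i; ring. Qed.

Lemma addr1K : cancel (fun j : int => j + 1) (fun j => j - 1).
Proof. by move=> i; ring. Qed.

Lemma reflectK : cancel (fun j : int => -1 - j) (fun j => -1 - j).
Proof. by move=> j; ring. Qed.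

Section ThetaCore.
Variable R : realType.
Local Notation C := (cplx R).
Variable tau : C.
Hypothesis htau : 0 < complex.Im tau.
Local Notation t := (complex.Im tau).
Local Notation P := (2 * pi : R).

Lemma two_pi_gt0 : 0 < P.
Proof. by rewrite mulr_gt0 ?pi_gt0. Qed.

(** The real number |q|^r. *)
Definition rho (r : R) : R := expR (- (P * (r * t))).

Lemma rhoD (a b : R) : rho (a + b) = rho a * rho b.
Proof. by rewrite /rho -expRD; congr expR; ring. Qed.

Lemma rho_gt0 a : 0 < rho a.
Proof. exact: expR_gt0. Qed.

Lemma rho_le a b : b <= a -> rho a <= rho b.
Proof.
by move=> ab; rewrite ler_expR lerN2 ler_wpM2l ?(ltW two_pi_gt0) // ler_wpM2r // ltW.
Qed.

(** (-1)^j q^(j(j+1)/2). *)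
Definition theta_coef (j : int) : C := e2pi (j%:~R / 2 + tri C j * tau).

Lemma cabs_theta_coef j : cabs (theta_coef j) = rho (tri R j).
Proof. by rewrite cabs_e2pi ImD Im_int_half add0r Im_triM. Qed.

Lemma e2pi_int_add (n : int) (z : C) : e2pi (n%:~R + z) = e2pi z.
Proof. by rewrite e2piD e2pi_int mul1r. Qed.

Lemma theta_coef_succ j : theta_coef (j + 1) = - (e2pi ((j%:~R + 1) * tau) * theta_coef j).
Proof.
by rewrite /theta_coef -e2piD oppr_e2pi; congr e2pi; rewrite /tri !rmorphD /=; field.
Qed.

Lemma theta_coef_pred j : theta_coef j = - (e2pi (j%:~R * tau) * theta_coef (j - 1)).
Proof.
rewrite (_ : theta_coef j = theta_coef (j - 1 + 1)); last by congr theta_coef; ring.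
by rewrite theta_coef_succ (_ : (j - 1)%:~R + 1 = j%:~R) // rmorphB /= subrK.
Qed.

(** The reflection j -> -1 - j fixes j(j+1)/2 and changes the parity; this is why
    Theta vanishes at u = 1. *)
Lemma theta_coef_refl j : theta_coef (- 1 - j) = - theta_coef j.
Proof.
rewrite /theta_coef oppr_e2pi -[RHS](e2pi_int_add (- 1 - j)); congr e2pi.
by rewrite /tri !(rmorphD, rmorphN) /=; field.
Qed.

Lemma absum_theta (u : C) : absum (fun j => cabs (theta_coef j * e2pi (j%:~R * u))).
Proof.
have a0 : 0 < P * t / 2 by rewrite divr_gt0 // mulr_gt0 // two_pi_gt0.
have := @absum_expR_quad R _ (- (P * t / 2) - P * complex.Im u) 0 a0.
apply: absum_le => j; rewrite cabsM cabs_theta_coef cabs_e2pi Im_intM /rho /tri -expRD.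
by rewrite ler_expR le_eqVlt; apply/orP; left; apply/eqP; field.
Qed.

Definition theta_series (u : C) : C :=
  summability.sum (fun j => theta_coef j * e2pi (j%:~R * u)).

Lemma has_sum_theta u : has_sum (fun j => theta_coef j * e2pi (j%:~R * u)) (theta_series u).
Proof. exact/absum_sum/absum_theta. Qed.

Lemma absum_theta_coef : absum (fun j => cabs (theta_coef j)).
Proof. by apply: absum_le (absum_theta 0) => j; rewrite mulr0 e2pi0 mulr1. Qed.

Lemma has_sum_theta_coef : has_sum theta_coef 0.
Proof.
have h : has_sum theta_coef (summability.sum theta_coef) by exact/absum_sum/absum_theta_coef.
have h2 : has_sum theta_coef (- summability.sum theta_coef).
  have := has_sumN (has_sum_reindex reflectK reflectK h).
  by apply: has_sum_ext => j; rewrite theta_coef_refl opprK.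
have := has_sum_unique h h2 => /eqP; rewrite -addr_eq0 -mulr2n -mulr_natl mulf_eq0 pnatr_eq0 /=.
by move=> /eqP e; rewrite e in h.
Qed.

(** A partial sum of the series Theta(1) = 0.  It is small at both ends: at
    +oo because the complete sum vanishes. *)
Definition theta_tail (j : int) : C :=
  summability.sum (fun i => if i <= j then theta_coef i else 0).

Lemma has_sum_theta_tail j : has_sum (fun i => if i <= j then theta_coef i else 0) (theta_tail j).
Proof.
apply: absum_sum; apply: absum_le absum_theta_coef => i.
by case: ifP => // _; rewrite cabs0 cabs_ge0.
Qed.

Lemma theta_tail_rec j : theta_tail j - theta_tail (j - 1) = theta_coef j.
Proof.
have := has_sumB (has_sum_theta_tail j) (has_sum_theta_tail (j - 1)).
move=> h; apply: has_sum_unique h _; apply: has_sum_ext (has_sum_delta j (theta_coef j)) => i.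
have [->|n] := eqVneq i j; first by rewrite lexx ifF ?subr0 //; lia.
by case: ifP; case: ifP; rewrite ?subrr ?subr0 //; lia.
Qed.

Lemma theta_tail_sym j : theta_tail (- 2 - j) = theta_tail j.
Proof.
have h1 := has_sumB has_sum_theta_coef (has_sum_theta_tail (-2 - j)).
have := has_sumN (has_sum_reindex reflectK reflectK h1).
rewrite sub0r opprK => h2; apply: has_sum_unique h2 _.
apply: has_sum_ext (has_sum_theta_tail j) => i.
rewrite theta_coef_refl (_ : (-1 - i <= -2 - j) = ~~ (i <= j)); last by lia.
by case: ifP => _ /=; rewrite ?subr0 ?subrr ?oppr0 ?opprK.
Qed.

(** For j <= -1 the sum defining the tail is dominated by its last term; the
    symmetry j -> -2 - j transports the bound to the other side.  Of the two
    exponents j(j+1)/2 and (j+1)(j+2)/2 the larger one is reached, hence both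
    bounds hold for every j. *)
Lemma theta_tail_bound : exists2 M : R, 0 <= M &
  forall j, cabs (theta_tail j) <= M * rho (tri R j) /\
            cabs (theta_tail j) <= M * rho (tri R (j + 1)).
Proof.
have Pt0 : 0 < P * t by rewrite mulr_gt0 ?two_pi_gt0.
have [M hM] := absum_expR_abs Pt0.
have M0 : 0 <= M by have := hM fset0; rewrite big_seq_fset0.
have key j : j <= -1 -> cabs (theta_tail j) <= M * rho (tri R j).
  move=> j1.
  have K1 : cancel (fun r : int => j + r) (fun r => - j + r) by move=> i; ring.
  have K2 : cancel (fun r : int => - j + r) (fun r => j + r) by move=> i; ring.
  have h := has_sum_reindex K1 K2 (has_sum_theta_tail j).
  apply: (@has_sum_bound _ _ _ _ (fun r => expR (- (P * t * `|r|%:~R)) * rho (tri R j))) h.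
    move=> r; case: ifP => hr; last by rewrite cabs0 mulr_ge0 ?expR_ge0.
    rewrite cabs_theta_coef -expRD ler_expR.
    have r0 : r <= 0 by lia.
    have jR : (j%:~R : R) <= -1 by rewrite -[-1](rmorphN1 intr) ler_int.
    have rR : (r%:~R : R) <= 0 by rewrite -[0]/(0%:~R) ler_int.
    have rr : (r%:~R : R) * (r%:~R + 1) >= 0.
      by rewrite -[1]/(1%:~R) -rmorphD -rmorphM /= -[0]/(0%:~R) ler_int; nia.
    have -> : (`|r|%:~R : R) = - r%:~R by rewrite ler0_norm // rmorphN.
    have : tri R (j + r) >= tri R j - r%:~R by rewrite /tri rmorphD /=; nra.
    nra.
  by move=> B; rewrite -mulr_suml ler_wpM2r ?(ltW (rho_gt0 _)).
exists M => // j; have [j1|j1] := leP j (-1).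
  split; first exact: key.
  apply: (le_trans (key _ j1)); rewrite ler_wpM2l // rho_le // /tri rmorphD /=.
  have jR : (j%:~R : R) <= -1 by rewrite -[-1](rmorphN1 intr) ler_int.
  nra.
have jR : -1 <= (j%:~R : R) by rewrite -[-1](rmorphN1 intr) ler_int ltW.
have k : cabs (theta_tail j) <= M * rho (tri R (j + 1)).
  rewrite -theta_tail_sym; have -> : tri R (j + 1) = tri R (-2 - j).
    by rewrite /tri !(rmorphD, rmorphN) /=; field.
  by apply: key; lia.
split=> //; apply: (le_trans k); rewrite ler_wpM2l // rho_le // /tri rmorphD /=.
nra.
Qed.

(** The coefficient of w^j in Theta(w) / (1 - w q^N), in closed form:
    (-1)^N q^(N j - N(N-1)/2) times the tail at j - N.  It equals
    sum_(i <= j) (-1)^i q^(i(i+1)/2 + N(j-i)), the formal quotient. *)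
Definition quot_coef (N j : int) : C :=
  e2pi (N%:~R / 2 + (N * j)%:~R * tau - tri C (N - 1) * tau) * theta_tail (j - N).

Lemma quot_coef_succ N j :
  quot_coef (N + 1) j = - (e2pi (j%:~R * tau) * quot_coef N (j - 1)).
Proof.
rewrite /quot_coef [in RHS]mulrA -e2piD -[RHS]mulNr oppr_e2pi; congr (e2pi _ * theta_tail _); last by ring.
by rewrite /tri !(rmorphD, rmorphN, rmorphM) /=; field.
Qed.

Lemma quot_coef_rec N j :
  e2pi (N%:~R * tau) * quot_coef N (j - 1) = quot_coef N j - theta_coef j.
Proof.
set z := e2pi (N%:~R / 2 + (N * j)%:~R * tau - tri C (N - 1) * tau).
have hz : theta_coef j = z * theta_coef (j - N).
  by rewrite /theta_coef -e2piD; congr e2pi; rewrite /tri !(rmorphD, rmorphN, rmorphM) /=; field.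
have -> : theta_coef j = quot_coef N j - z * theta_tail (j - N - 1) by rewrite hz -theta_tail_rec mulrBr.
rewrite subKr /quot_coef mulrA -e2piD.
congr (e2pi _ * theta_tail _); last by ring.
by rewrite /tri !(rmorphD, rmorphN, rmorphM) /=; field.
Qed.

Lemma quot_coef_bound : exists2 M : R, 0 <= M & forall N j,
  cabs (quot_coef N j) <= M * rho (tri R j) /\
  cabs (quot_coef N j) <= M * rho (tri R (j + 1) - N%:~R).
Proof.
have [M M0 hM] := theta_tail_bound; exists M => // N j.
have h : cabs (quot_coef N j) = rho (N%:~R * j%:~R - tri R (N - 1)) * cabs (theta_tail (j - N)).
  rewrite /quot_coef cabsM cabs_e2pi !ImD ImN Im_int_half Im_intM Im_triM rmorphM /=.
  by rewrite /rho; congr (expR _ * _); ring.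
have [h1 h2] := hM (j - N); split.
  have -> : tri R j = (N%:~R * j%:~R - tri R (N - 1)) + tri R (j - N).
    by rewrite /tri !(rmorphD, rmorphN) /=; field.
  by rewrite rhoD h mulrCA ler_wpM2l // (ltW (rho_gt0 _)).
have -> : tri R (j + 1) - N%:~R = (N%:~R * j%:~R - tri R (N - 1)) + tri R (j - N + 1).
  by rewrite /tri !(rmorphD, rmorphN) /=; field.
by rewrite rhoD h mulrCA ler_wpM2l // (ltW (rho_gt0 _)).
Qed.

(** Multiplying the series by 1 - w q^N gives Theta(w), by the second recurrence. *)
Lemma has_sum_quot_coef (N : int) (w : C) : e2pi (w + N%:~R * tau) != 1 ->
  has_sum (fun j => e2pi (j%:~R * w) * quot_coef N j)
    (theta_series w / (1 - e2pi (w + N%:~R * tau))).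
Proof.
move=> hw.
have [M M0 hM] := quot_coef_bound.
have h : has_sum (fun j => e2pi (j%:~R * w) * quot_coef N j)
    (summability.sum (fun j => e2pi (j%:~R * w) * quot_coef N j)).
  apply: absum_sum; apply: absum_le (absumZ M0 (absum_theta w)) => j.
  rewrite [leLHS]cabsM [cabs (theta_coef j * _)]cabsM cabs_theta_coef mulrA [leLHS]mulrC.
  by rewrite ler_wpM2r ?cabs_ge0 // (hM N j).1.
set D := summability.sum _ in h.
have n0 : 1 - e2pi (w + N%:~R * tau) != 0 by rewrite subr_eq0 eq_sym.
have h2 := has_sumZ (e2pi (w + N%:~R * tau)) (has_sum_reindex subr1K addr1K h).
have h3 : has_sum (fun j => theta_coef j * e2pi (j%:~R * w)) (D - e2pi (w + N%:~R * tau) * D).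
  apply: has_sum_ext (has_sumB h h2) => j /=.
  rewrite e2piD (_ : e2pi (j%:~R * w) = e2pi w * e2pi ((j - 1)%:~R * w)); last first.
    by rewrite -e2piD; congr e2pi; rewrite rmorphB /=; ring.
  have e := quot_coef_rec N j.
  have -> : theta_coef j = quot_coef N j - e2pi (N%:~R * tau) * quot_coef N (j - 1) by rewrite e; ring.
  ring.
have <- : D * (1 - e2pi (w + N%:~R * tau)) = theta_series w.
  by rewrite mulrBr mulr1 [D * _]mulrC; exact: has_sum_unique h3 (has_sum_theta w).
by rewrite mulfK.
Qed.

(** The size min (1, |q|^(-N)) of 1 / (1 - w q^N) as N varies; it also controls
    the coefficients T(N, j) uniformly in N. *)
Definition weight (N : int) : R := if 0 <= N then 1 else rho (- N%:~R).

Lemma weight_ge0 N : 0 <= weight N.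
Proof. by rewrite /weight; case: ifP => // _; exact: ltW (rho_gt0 _). Qed.

Lemma quot_coef_weight : exists2 M : R, 0 <= M & forall N j,
  cabs (quot_coef N j) <= weight N * (M * (rho (tri R j) + rho (tri R (j + 1)))).
Proof.
have [M M0 hM] := quot_coef_bound; exists M => // N j; rewrite /weight.
have [h1 h2] := hM N j; have r1 := ltW (rho_gt0 (tri R j)).
have r2 := ltW (rho_gt0 (tri R (j + 1))).
case: ifP => _.
  by rewrite mul1r (le_trans h1) // ler_wpM2l // lerDl.
apply: (le_trans h2); rewrite rhoD mulrA [leRHS]mulrC ler_wpM2r ?(ltW (rho_gt0 _)) //.
by rewrite ler_wpM2l // lerDr.
Qed.

Section Expansion.
Variables (I : choiceType) (b : I -> C) (nu : I -> int).
Hypothesis hb : absum (fun i => cabs (b i) * weight (nu i)).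

Definition expansion_coef (j : int) : C := summability.sum (fun i => b i * quot_coef (nu i) j).

Lemma has_sum_expansion_coef j : has_sum (fun i => b i * quot_coef (nu i) j) (expansion_coef j).
Proof.
apply: absum_sum; have [M M0 hM] := quot_coef_weight.
have K0 : 0 <= M * (rho (tri R j) + rho (tri R (j + 1))).
  by rewrite mulr_ge0 // addr_ge0 // ltW // rho_gt0.
apply: absum_le (absumZ K0 hb) => i; rewrite [leLHS]cabsM mulrCA.
by rewrite ler_wpM2l ?cabs_ge0 // mulrC hM.
Qed.

(** Both sums are iterated sums of the same absolutely summable double family
    b_i w^j T(nu_i, j). *)
Lemma theta_expansion (w : C) : (forall n : int, e2pi (w + n%:~R * tau) != 1) ->
  exists2 s, has_sum (fun i => theta_series w * (b i / (1 - e2pi (w + (nu i)%:~R * tau)))) s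
           & has_sum (fun j => e2pi (j%:~R * w) * expansion_coef j) s.
Proof.
move=> hw; have [M M0 hM] := quot_coef_weight.
pose g (j : int) : R := M * (cabs (theta_coef j * e2pi (j%:~R * w)) +
  cabs (theta_coef (j + 1) * e2pi ((j + 1)%:~R * w)) * cabs (e2pi (- w))).
have g0 j : 0 <= g j by rewrite mulr_ge0 // addr_ge0 ?mulr_ge0 ?cabs_ge0.
have ag : absum g.
  apply: absumZ => //; apply: absumD; first exact: absum_theta.
  apply: absum_le (absumZ (cabs_ge0 (e2pi (- w))) (absum_inj (addIr 1) _ (absum_theta w))).
    by move=> j; rewrite mulrC.
  by move=> j; exact: cabs_ge0.
have gE j : g j = cabs (e2pi (j%:~R * w)) * (M * (rho (tri R j) + rho (tri R (j + 1)))).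
  have e1 : cabs (theta_coef j * e2pi (j%:~R * w)) = rho (tri R j) * cabs (e2pi (j%:~R * w)).
    by rewrite cabsM cabs_theta_coef.
  have e2 : cabs (theta_coef (j + 1) * e2pi ((j + 1)%:~R * w)) * cabs (e2pi (- w)) =
      rho (tri R (j + 1)) * cabs (e2pi (j%:~R * w)).
    rewrite cabsM cabs_theta_coef -mulrA -cabsM -e2piD; congr (_ * cabs (e2pi _)).
    by rewrite rmorphD /=; ring.
  by rewrite /g e1 e2; ring.
have hbm i : 0 <= cabs (b i) * weight (nu i) by rewrite mulr_ge0 ?cabs_ge0 ?weight_ge0.
pose f (p : I * int) : C := b p.1 * (e2pi (p.2%:~R * w) * quot_coef (nu p.1) p.2).
have af : absum (fun p => cabs (f p)).
  apply: absum_le (absum_prod hbm g0 hb ag) => -[i j] /=.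
  rewrite /f [leLHS]cabsM -mulrA ler_wpM2l ?cabs_ge0 // [leLHS]cabsM gE mulrCA.
  by rewrite ler_wpM2l ?cabs_ge0.
have hf := absum_sum af.
exists (summability.sum f).
  apply: (has_sum_sigma hf) => i /=; rewrite /f /=.
  by rewrite mulrCA; apply: has_sumZ; exact: has_sum_quot_coef.
apply: (has_sum_swap hf) => j; apply: has_sum_ext (has_sumZ (e2pi (j%:~R * w)) (has_sum_expansion_coef j)) => i.
by rewrite /f mulrCA.
Qed.

Lemma theta_expansion_sum (w : C) : (forall n : int, e2pi (w + n%:~R * tau) != 1) ->
  has_sum (fun j => e2pi (j%:~R * w) * expansion_coef j)
    (theta_series w * summability.sum (fun i => b i / (1 - e2pi (w + (nu i)%:~R * tau)))).
Proof. by move=> /theta_expansion[s /has_sumZI ->]. Qed.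

Lemma has_sum_quotient (w : C) : (forall n : int, e2pi (w + n%:~R * tau) != 1) ->
  theta_series w != 0 -> has_sum (fun i => b i / (1 - e2pi (w + (nu i)%:~R * tau)))
    (summability.sum (fun i => b i / (1 - e2pi (w + (nu i)%:~R * tau)))).
Proof.
move=> hw nz; have [s h1 _] := theta_expansion hw.
rewrite -[X in has_sum _ X](mulKf nz) (has_sumZI h1).
by apply: has_sum_ext (has_sumZ (theta_series w)^-1 h1) => i; rewrite mulKf.
Qed.

End Expansion.

(** The numerator of mu: an Appell-Lerch sum. *)
Definition appell (x u : C) : C :=
  summability.sum (fun n => theta_coef n * e2pi (n%:~R * u) / (1 - e2pi (x + n%:~R * tau))).

Lemma absum_theta_weight x : absum (fun n => cabs (theta_coef n * e2pi (n%:~R * x)) * weight n).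
Proof.
have h := absumD (absum_theta x) (absum_theta (x - tau)).
apply: absum_le h => n; rewrite /weight; case: ifP => _.
  by rewrite mulr1 lerDl cabs_ge0.
apply: ler_wpDl; first exact: cabs_ge0.
have -> : rho (- n%:~R) = cabs (e2pi (n%:~R * - tau)).
  by rewrite cabs_e2pi Im_intM ImN /rho; congr expR; ring.
by rewrite -cabsM -mulrA -e2piD -mulrDr.
Qed.

(** Replacing n by n + 1 in the sum multiplies the n-th term of the family by
    - x q^(n+1) and T(n, j) by a factor that the first recurrence supplies; the
    second recurrence brings back T(n, j). *)
Lemma theta_expansion_coef x j :
  (1 - e2pi (x + (j + 1)%:~R * tau)) *
    expansion_coef (fun n => theta_coef n * e2pi (n%:~R * x)) id j =
  - (e2pi (x + (j + 1)%:~R * tau) * (theta_coef j * theta_series x)).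
Proof.
set b := fun n : int => _; set z := e2pi _.
have hL := has_sum_expansion_coef (absum_theta_weight x) j; rewrite -/b in hL.
have h1 := has_sum_reindex addr1K subr1K hL.
have h2 : has_sum (fun n => b (n + 1) * quot_coef (n + 1) j) (z * (expansion_coef b id j - theta_coef j * theta_series x)).
  apply: has_sum_ext (has_sumZ z (has_sumB hL (has_sumZ (theta_coef j) (has_sum_theta x)))) => n.
  rewrite quot_coef_succ /b theta_coef_succ /= -[theta_coef j * _]mulrC -mulrBr -quot_coef_rec.
  rewrite mulrCA -/(b n) /b.
  have -> : e2pi ((n + 1)%:~R * x) = e2pi x * e2pi (n%:~R * x).
    by rewrite -e2piD; congr e2pi; rewrite rmorphD /=; ring.
  have -> : z = e2pi x * e2pi ((j%:~R + 1) * tau) by rewrite /z -e2piD rmorphD.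
  rewrite !mulrDl !mul1r !e2piD.
  ring.
have e := has_sum_unique h1 h2.
by rewrite mulrBl mul1r [X in X - _]e; ring.
Qed.

Lemma e2pi_tau_neq1 (n : int) : n != 0 -> e2pi (n%:~R * tau) != 1.
Proof.
move=> n0; apply/eqP => /e2pi_eq1_Im/eqP.
by rewrite Im_intM mulf_eq0 intr_eq0 (negPf n0) gt_eqF.
Qed.

Lemma strip_neq1 (z : C) : 0 < complex.Im z < t ->
  forall n : int, e2pi (z + n%:~R * tau) != 1.
Proof.
move=> /andP[z0 zt] n; apply/eqP => /e2pi_eq1_Im; rewrite ImD Im_intM => e.
have [n0|n0] := leP 0 n.
  have : (0 <= n%:~R :> R) by rewrite ler0z.
  nra.
have : (n%:~R : R) <= -1 by rewrite -[-1](rmorphN1 intr) ler_int; lia.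
nra.
Qed.

(** The zero of Theta at 1/q, obtained from the one at 1 by shifting the index. *)
Lemma theta_series_opp_tau : theta_series (- tau) = 0.
Proof.
have h := has_sumN (has_sum_reindex subr1K addr1K has_sum_theta_coef).
rewrite oppr0 in h; apply: has_sum_unique h.
apply: has_sum_ext (has_sum_theta (- tau)) => j.
rewrite -[in LHS](subr1K j) theta_coef_succ mulNr mulrAC -e2piD.
rewrite (_ : ((j - 1)%:~R + 1) * tau + (j - 1 + 1)%:~R * - tau = 0) ?e2pi0 ?mul1r //.
by rewrite !rmorphD rmorphN /=; ring.
Qed.

Definition tail_total : C := summability.sum theta_tail.

Lemma has_sum_tail : has_sum theta_tail tail_total.
Proof.
have [M M0 hM] := theta_tail_bound; apply: absum_sum.
by apply: absum_le (absumZ M0 absum_theta_coef) => j; rewrite cabs_theta_coef; exact: (hM j).1.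
Qed.

(** At x = 1/q the equation [theta_expansion_coef] reads (1 - q^j) L(j) = 0, so
    only the constant coefficient survives. *)
Lemma theta_appell_opp_tau (u : C) : (forall n : int, e2pi (u + n%:~R * tau) != 1) ->
  theta_series u * appell u (- tau) = tail_total.
Proof.
move=> hu; have hb := absum_theta_weight (- tau).
have h := theta_expansion_sum hb hu; rewrite -/(appell u (- tau)) in h.
set L0 := expansion_coef _ _ in h.
have hz j : j != 0 -> L0 j = 0.
  move=> j0; have := theta_expansion_coef (- tau) j; rewrite theta_series_opp_tau !mulr0 oppr0 => /eqP.
  rewrite mulf_eq0 subr_eq0 eq_sym => /orP[|/eqP //].
  rewrite (_ : - tau + (j + 1)%:~R * tau = j%:~R * tau); last by rewrite rmorphD /=; ring.
  by rewrite (negPf (e2pi_tau_neq1 j0)).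
have -> : theta_series u * appell u (- tau) = L0 0.
  apply: has_sum_unique h _; apply: has_sum_ext (has_sum_delta 0 _) => j.
  by have [->|/hz ->] := eqVneq j 0; rewrite ?mul0r ?e2pi0 ?mul1r ?mulr0.
apply: has_sum_unique (has_sum_expansion_coef hb 0) _.
apply: has_sum_ext (has_sum_reindex (@opprK int) (@opprK int) has_sum_tail) => n.
rewrite /quot_coef mulr0 mul0r addr0 sub0r mulrA /theta_coef -!e2piD -[LHS]mul1r; congr (_ * _).
transitivity (e2pi (n%:~R : C)); first by rewrite e2pi_int.
congr e2pi; by rewrite /tri !(rmorphD, rmorphN) /=; field.
Qed.

Lemma theta_series_neq0 (u : C) : tail_total != 0 ->
  (forall n : int, e2pi (u + n%:~R * tau) != 1) ->
  theta_series u != 0.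
Proof.
by move=> hJ /theta_appell_opp_tau h; apply: contraNneq hJ => h0; rewrite -h h0 mul0r.
Qed.

(** The symmetry mu (z1, z2) = mu (z2, z1): [theta_expansion_coef] computes the
    expansion of Theta(y) A(y, x) in powers of y, which is the series defining
    A(x, y). *)
Lemma reciprocity (x y : C) : (forall n : int, e2pi (x + n%:~R * tau) != 1) ->
  (forall n : int, e2pi (y + n%:~R * tau) != 1) ->
  e2pi x * theta_series x * appell x y = e2pi y * theta_series y * appell y x.
Proof.
move=> hx hy; apply: has_sumZI.
have h := theta_expansion_sum (absum_theta_weight x) hy; rewrite -/(appell y x) in h.
have h2 := has_sum_reindex subr1K addr1K (has_sumZ (e2pi y) h).
rewrite mulrA in h2; apply: has_sum_ext h2 => n.
have hn := theta_expansion_coef x (n - 1); rewrite subr1K in hn.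
have nz : 1 - e2pi (x + n%:~R * tau) != 0 by rewrite subr_eq0 eq_sym.
set Lx := expansion_coef _ _ _ in hn *; set q := e2pi (x + _) in hn nz *.
have e1 : e2pi (n%:~R * y) = e2pi y * e2pi ((n - 1)%:~R * y).
  by rewrite -e2piD; congr e2pi; rewrite rmorphB /=; ring.
have e2 : e2pi x * theta_coef n = - (q * theta_coef (n - 1)).
  by rewrite theta_coef_pred /q e2piD; ring.
transitivity (e2pi y * e2pi ((n - 1)%:~R * y) * ((1 - q) * Lx) / (1 - q)); first by field.
rewrite hn (_ : e2pi x * _ * _ = (e2pi x * theta_coef n) * theta_series x * e2pi (n%:~R * y) / (1 - q)).
  by rewrite e1 e2; field.
by field.
Qed.

(** The sign of the expansion of 1 / (1 - u q^n) into powers of u: one geometric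
    series for n >= 0, the opposite one, in negative powers, for n < 0. *)
Definition quad_sign (k l : int) : C :=
  if (0 <= k) && (0 <= l) then 1 else if (k < 0) && (l < 0) then -1 else 0.

Lemma quad_signC k l : quad_sign k l = quad_sign l k.
Proof. by rewrite /quad_sign andbC [(k < 0) && _]andbC. Qed.

(** Shifting the first quadrant pair by one changes it only along k = 0: this is
    where the one-dimensional geometric family comes from. *)
Lemma quad_sign_diff k l : quad_sign k l - quad_sign (k - 1) l = if k == 0 then 1 else 0.
Proof.
rewrite /quad_sign; have [->|k0] := eqVneq k 0.
  by case: (leP 0 l) => l0; rewrite ?andbF ?andbT /= ?subr0 ?sub0r ?opprK.
have -> : (0 <= k - 1) = (0 <= k) by lia.
have -> : (k - 1 < 0) = (k < 0) by lia.
exact: subrr.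
Qed.

Lemma cabs_quad_sign k l : cabs (quad_sign k l) <= 1.
Proof. by rewrite /quad_sign; case: ifP => _; [|case: ifP => _]; rewrite ?cabsN ?cabs1 ?cabs0. Qed.

(** Multiplying by 1 - e2pi v telescopes the series, by [quad_sign_diff]. *)
Lemma quad_sign_geometric (k : int) (v : C) :
  (if 0 <= k then 0 < complex.Im v else complex.Im v < 0) ->
  has_sum (fun m => quad_sign k m * e2pi (m%:~R * v)) (1 / (1 - e2pi v)).
Proof.
move=> hv.
have d0 : 0 < P * `|complex.Im v|.
  by rewrite mulr_gt0 ?two_pi_gt0 // normr_gt0; case: ifP hv => _ h; [rewrite gt_eqF|rewrite lt_eqF].
have h : has_sum (fun m => quad_sign k m * e2pi (m%:~R * v))
    (summability.sum (fun m => quad_sign k m * e2pi (m%:~R * v))).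
  apply: absum_sum; apply: absum_le (absum_expR_abs d0) => m.
  rewrite /quad_sign cabsM cabs_e2pi Im_intM.
  case: (leP 0 k) hv => k0 hv; case: (leP 0 m) => m0 /=;
    rewrite ?cabsN ?cabs0 ?cabs1 ?mul0r ?mul1r ?ler_expR ?lerN2 ?expR_ge0 //.
    by rewrite (gtr0_norm hv) (ger0_norm m0) -mulrA [_ * complex.Im v]mulrC.
  rewrite (ltr0_norm hv) (ltr0_norm m0) rmorphN /=; lra.
set s := summability.sum _ in h.
have vn : 1 - e2pi v != 0.
  rewrite subr_eq0 eq_sym; apply/eqP => /e2pi_eq1_Im e0; move: hv; rewrite e0 ltxx.
  by case: ifP.
suff e : s * (1 - e2pi v) = 1 by rewrite -(mulfK vn s) e in h.
rewrite mulrBr mulr1 [s * _]mulrC.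
have h2 := has_sumB h (has_sumZ (e2pi v) (has_sum_reindex subr1K addr1K h)).
apply: has_sum_unique h2 _; apply: has_sum_ext (has_sum_delta 0 1) => m.
have -> : e2pi (m%:~R * v) = e2pi v * e2pi ((m - 1)%:~R * v).
  by rewrite -e2piD; congr e2pi; rewrite rmorphB /=; ring.
rewrite [in RHS]mulrCA -[in RHS]mulrBr -mulrBl quad_signC [quad_sign k (m - 1)]quad_signC quad_sign_diff.
have [->|_] := eqVneq m 0; last by rewrite mul0r mulr0.
rewrite mul1r -e2piD sub0r rmorphN mulN1r subrr e2pi0 //.
Qed.

Section Strip.
Variables x y : C.
Hypothesis hy : 0 < complex.Im y < t.

(** (-1)^k q^(k(k+1)/2) x^k y^l q^(k l). *)
Definition beta (k l : int) : C :=
  theta_coef k * e2pi (k%:~R * x + l%:~R * y + (k * l)%:~R * tau).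

Definition theta_bound (k : int) : R :=
  cabs (theta_coef k * e2pi (k%:~R * x)) + cabs (theta_coef k * e2pi (k%:~R * (x - tau))).

(** An exponential bound on y^l for l >= 0 and on (y/q)^l for l < 0, valid because
    |q| < |y| < 1. *)
Definition decay (z : C) (l : int) : R :=
  expR (- (P * Num.min (complex.Im z) (t - complex.Im z) * `|l|%:~R)).

Lemma theta_bound_ge0 k : 0 <= theta_bound k.
Proof. by rewrite addr_ge0 ?cabs_ge0. Qed.

Lemma decay_ge0 z l : 0 <= decay z l.
Proof. exact: expR_ge0. Qed.

Lemma absum_theta_bound : absum theta_bound.
Proof. by apply: absumD; exact: absum_theta. Qed.

Lemma absum_decay z : 0 < complex.Im z < t -> absum (decay z).
Proof.
move=> /andP[h1 h2]; apply: absum_expR_abs.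
by rewrite mulr_gt0 ?two_pi_gt0 // lt_min h1 subr_gt0.
Qed.

Lemma decay_pos z l : 0 <= l -> cabs (e2pi (l%:~R * z)) <= decay z l.
Proof.
move=> l0; rewrite cabs_e2pi Im_intM ler_expR lerN2 (ger0_norm l0) -mulrA.
rewrite ler_wpM2l ?(ltW two_pi_gt0) // mulrC ler_wpM2l ?ler0z //.
by rewrite ge_min lexx.
Qed.

Lemma decay_neg z l : l < 0 -> cabs (e2pi (l%:~R * (z - tau))) <= decay z l.
Proof.
move=> l0; rewrite cabs_e2pi Im_intM ler_expR lerN2 (ltr0_norm l0) -mulrA.
rewrite ler_wpM2l ?(ltW two_pi_gt0) // ImD ImN rmorphN /=.
have h : Num.min (complex.Im z) (t - complex.Im z) <= t - complex.Im z.
  by rewrite ge_min lexx orbT.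
have lR : (l%:~R : R) <= 0 by rewrite -[0]/(0%:~R) ler_int ltW.
nra.
Qed.

Lemma rho_neg_int (n : int) : rho (- n%:~R) = cabs (e2pi (n%:~R * - tau)).
Proof. by rewrite cabs_e2pi Im_intM ImN /rho; congr expR; ring. Qed.

Lemma weight_bound k l : (0 <= k) && (0 <= l) || (k <= 0) && (l < 0) ->
  cabs (theta_coef k * e2pi (k%:~R * x)) * cabs (e2pi (l%:~R * y)) * weight (k + l)
    <= theta_bound k * decay y l.
Proof.
move=> /orP[/andP[k0 l0]|/andP[k0 l0]].
  rewrite /weight addr_ge0 // mulr1 ler_pM ?cabs_ge0 ?decay_pos //.
  by rewrite /theta_bound lerDl cabs_ge0.
have -> : weight (k + l) = cabs (e2pi (k%:~R * - tau)) * cabs (e2pi (l%:~R * - tau)).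
  rewrite /weight ifF; last by lia.
  by rewrite rho_neg_int -cabsM -e2piD -mulrDl rmorphD.
have e1 : cabs (theta_coef k * e2pi (k%:~R * x)) * cabs (e2pi (k%:~R * - tau)) =
    cabs (theta_coef k * e2pi (k%:~R * (x - tau))).
  by rewrite -cabsM -mulrA -e2piD -mulrDr.
have e2 : cabs (e2pi (l%:~R * y)) * cabs (e2pi (l%:~R * - tau)) =
    cabs (e2pi (l%:~R * (y - tau))) by rewrite -cabsM -e2piD -mulrDr.
rewrite mulrACA e1 e2 ler_pM ?cabs_ge0 ?decay_neg //.
by rewrite /theta_bound lerDr cabs_ge0.
Qed.

Lemma cabs_beta k l : cabs (beta k l) =
  cabs (theta_coef k * e2pi (k%:~R * x)) * cabs (e2pi (l%:~R * y)) * rho (k * l)%:~R.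
Proof.
rewrite /beta !e2piD !cabsM !mulrA; congr (_ * _).
by rewrite [LHS]cabs_e2pi Im_intM.
Qed.

Lemma rho_le1 a : 0 <= a -> rho a <= 1.
Proof. by move=> /rho_le h; rewrite (le_trans h) // /rho mul0r mulr0 oppr0 expR0. Qed.

Lemma absum_theta_bound_decay : absum (fun p : int * int => theta_bound p.1 * decay y p.2).
Proof.
by apply: absum_prod; [exact: theta_bound_ge0|exact: decay_ge0|exact: absum_theta_bound|exact: absum_decay].
Qed.

Lemma quad_sign_support k l :
  quad_sign k l = 0 \/ (0 <= k) && (0 <= l) || (k <= 0) && (l < 0).
Proof.
rewrite /quad_sign; case: ifP => _; first by right.
case: ifP => [/andP[k0 l0]|_]; [right|by left].
by rewrite (ltW k0) l0 orbT.
Qed.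

Lemma quad_sign_pred_support k l :
  quad_sign (k - 1) l = 0 \/ (0 <= k) && (0 <= l) || (k <= 0) && (l < 0).
Proof.
rewrite /quad_sign; case: ifP => [/andP[k0 l0]|_]; [|case: ifP => [/andP[k0 l0]|_]; last by left].
  right; lia.
right; lia.
Qed.

Definition shifted_term (p : int * int) : C := quad_sign (p.1 - 1) p.2 * beta p.1 p.2.
Definition quad_term (p : int * int) : C := quad_sign p.1 p.2 * beta p.1 p.2.
Definition geom_term (l : int) : C := e2pi (l%:~R * y).
Definition degree (p : int * int) : int := p.1 + p.2.

Lemma beta_weight k l (e : C) : cabs e <= 1 ->
  (e = 0 \/ (0 <= k) && (0 <= l) || (k <= 0) && (l < 0)) ->
  cabs (e * beta k l) * weight (k + l) <= theta_bound k * decay y l.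
Proof.
move=> e1 [->|h]; first by rewrite mul0r cabs0 mul0r mulr_ge0 ?theta_bound_ge0 ?decay_ge0.
apply: le_trans (weight_bound h); rewrite cabsM cabs_beta ler_wpM2r ?weight_ge0 //.
rewrite -[leRHS]mul1r ler_pM ?mulr_ge0 ?cabs_ge0 ?(ltW (rho_gt0 _)) //.
rewrite -[leRHS]mulr1 ler_wpM2l ?mulr_ge0 ?cabs_ge0 // rho_le1 // ler0z; nia.
Qed.

Lemma absum_shifted_term : absum (fun p => cabs (shifted_term p) * weight (degree p)).
Proof.
apply: absum_le absum_theta_bound_decay => -[k l]; apply: beta_weight; first exact: cabs_quad_sign.
exact: quad_sign_pred_support.
Qed.

Lemma absum_quad_term : absum (fun p => cabs (quad_term p) * weight (degree p)).
Proof.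
apply: absum_le absum_theta_bound_decay => -[k l]; apply: beta_weight; first exact: cabs_quad_sign.
exact: quad_sign_support.
Qed.

Lemma absum_geom_term : absum (fun l => cabs (geom_term l) * weight (id l)).
Proof.
have h := absumZ (theta_bound_ge0 0) (absum_decay hy); apply: absum_le h => l.
have := @weight_bound 0 l; rewrite add0r lexx /= => /(_ _) h.
apply: le_trans (h _); last by lia.
rewrite mul0r e2pi0 mulr1 /theta_coef mul0r add0r (_ : tri C 0 = 0) ?mul0r ?e2pi0 ?cabs1 ?mul1r //.
by rewrite /tri mul0r mul0r.
Qed.

(** Without the weight, the terms with k, l < 0 are still summable because
    k l >= -1 - k - l there. *)
Lemma absum_quad_term_unweighted : absum (fun p => cabs (quad_term p)).
Proof.
have r0 : 0 <= rho (-1) + 1 by rewrite addr_ge0 // ltW // rho_gt0.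
apply: absum_le (absumZ r0 absum_theta_bound_decay) => -[k l] /=; rewrite /quad_term /=.
have [->|hs] := quad_sign_support k l.
  by rewrite mul0r cabs0 !mulr_ge0 ?theta_bound_ge0 ?decay_ge0.
have [->|nz] := eqVneq (quad_sign k l) 0.
  by rewrite mul0r cabs0 !mulr_ge0 ?theta_bound_ge0 ?decay_ge0.
apply: le_trans (ler_wpM2l r0 (weight_bound hs)).
rewrite cabsM cabs_beta; set a := cabs (theta_coef k * _) * _.
have a0 : 0 <= a by rewrite mulr_ge0 ?cabs_ge0.
rewrite mulrCA [leRHS]mulrCA ler_wpM2l //.
apply: (@le_trans _ _ (rho (k * l)%:~R)).
  by rewrite -[leRHS]mul1r ler_wpM2r ?cabs_quad_sign // ltW // rho_gt0.
rewrite mulrDl mul1r.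
move: nz; rewrite /quad_sign /weight; case: ifP => [/andP[k0 l0] _|_].
  rewrite addr_ge0 // mulr1; apply: ler_wpDl; first exact: ltW (rho_gt0 _).
  by apply: rho_le1; rewrite ler0z mulr_ge0.
case: ifP => [/andP[k0 l0] _|_]; last by rewrite eqxx.
rewrite ifF; last by lia.
apply: ler_wpDr; first exact: ltW (rho_gt0 _).
rewrite -rhoD rho_le //.
have : (- 1 - (k + l) <= k * l :> int) by nia.
by rewrite -(ler_int R) rmorphB /= rmorphN1.
Qed.

(** Expand each 1 / (1 - y q^k) of A(y, x) into a geometric series. *)
Lemma appell_double_sum : has_sum quad_term (appell y x).
Proof.
have h := absum_sum absum_quad_term_unweighted; suff -> : appell y x = summability.sum quad_term by [].
apply: has_sum_sum; apply: (has_sum_sigma h) => k.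
have hk : if 0 <= k then 0 < complex.Im (y + k%:~R * tau)
          else complex.Im (y + k%:~R * tau) < 0.
  rewrite ImD Im_intM; case/andP: hy => y0 yt; case: (leP 0 k) => k0.
    by rewrite ltr_wpDr // mulr_ge0 ?ler0z // ltW.
  have : (k%:~R : R) <= -1 by rewrite -[-1](rmorphN1 intr) ler_int; lia.
  nra.
have := has_sumZ (theta_coef k * e2pi (k%:~R * x)) (quad_sign_geometric hk).
rewrite mul1r; apply: has_sum_ext => l; rewrite mulrCA /quad_term /beta /=; congr (_ * _).
rewrite -mulrA -e2piD; congr (_ * e2pi _); rewrite rmorphM /=; ring.
Qed.

Let shifted_coef := expansion_coef shifted_term degree.
Let quad_coef := expansion_coef quad_term degree.
Let geom_coef := expansion_coef geom_term id.

(** The two families differ by the terms with k = 0, which are y^l. *)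
Lemma quad_coef_split j : quad_coef j = shifted_coef j + geom_coef j.
Proof.
have h := has_sumB (has_sum_expansion_coef absum_quad_term j) (has_sum_expansion_coef absum_shifted_term j).
have h2 : has_sum (fun k : int => if k == 0 then geom_coef j else 0) (quad_coef j - shifted_coef j).
  refine (@has_sum_sigma R int int _ _ _ h _) => k.
  have := has_sumZ (if k == 0 then 1 else 0) (has_sum_expansion_coef absum_geom_term j).
  rewrite -/geom_coef (_ : (if _ then _ else _) * _ = if k == 0 then geom_coef j else 0); last first.
    by case: ifP => _; rewrite ?mul1r ?mul0r.
  apply: has_sum_ext => l; rewrite /quad_term /shifted_term /degree /= -mulrBl -mulrBl quad_sign_diff.
  case: eqP => [->|_]; last by rewrite !mul0r.
  rewrite !mul1r add0r /geom_term /beta; congr (_ * _).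
  rewrite mul0r mul0r mul0r !addr0 add0r /theta_coef mul0r add0r (_ : tri C 0 = 0) ?mul0r ?e2pi0 ?mul1r //.
  by rewrite /tri mul0r mul0r.
have := has_sum_unique h2 (has_sum_delta 0 (geom_coef j)) => <-; ring.
Qed.

(** The shift k -> k + 1 maps the index pattern of the first family to that of the
    second one; the recurrences for T do the rest, as in [theta_expansion_coef]. *)
Lemma shifted_coef_shift j : shifted_coef j =
  e2pi (x + (j + 1)%:~R * tau) * (quad_coef j - theta_coef j * appell y x).
Proof.
have K1 : cancel (fun p : int * int => (p.1 - 1, p.2)) (fun p => (p.1 + 1, p.2)).
  by move=> [k l] /=; rewrite subrK.
have K2 : cancel (fun p : int * int => (p.1 + 1, p.2)) (fun p => (p.1 - 1, p.2)).
  by move=> [k l] /=; rewrite addrK.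
have h1 := has_sum_reindex K2 K1 (has_sum_expansion_coef absum_shifted_term j).
have h2 := has_sumZ (e2pi (x + (j + 1)%:~R * tau))
  (has_sumB (has_sum_expansion_coef absum_quad_term j) (has_sumZ (theta_coef j) appell_double_sum)).
apply: has_sum_unique h1 _; apply: has_sum_ext h2 => -[k l] /=.
have eB : beta (k + 1) l = - (e2pi ((k + l)%:~R * tau) * e2pi x * e2pi tau * beta k l).
  rewrite /beta theta_coef_succ mulNr; congr (- _); rewrite mulrAC [RHS]mulrCA [RHS]mulrC -!e2piD.
  by congr e2pi; rewrite !(rmorphD, rmorphM) /=; ring.
have eT := quot_coef_rec (k + l) j.
have -> : quot_coef (k + l) j = theta_coef j + e2pi ((k + l)%:~R * tau) * quot_coef (k + l) (j - 1).
  by rewrite eT; ring.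
rewrite /shifted_term /quad_term /degree /= addrK (_ : k + 1 + l = k + l + 1); last by ring.
have -> : e2pi (x + (j + 1)%:~R * tau) = e2pi x * e2pi (j%:~R * tau) * e2pi tau.
  by rewrite -!e2piD; congr e2pi; rewrite rmorphD /=; ring.
by rewrite quot_coef_succ eB; ring.
Qed.

Lemma shifted_coefE j : (1 - e2pi (x + (j + 1)%:~R * tau)) * shifted_coef j =
  e2pi (x + (j + 1)%:~R * tau) * (geom_coef j - theta_coef j * appell y x).
Proof. by have := shifted_coef_shift j; rewrite quad_coef_split => h; rewrite mulrBl mul1r {1}h; ring. Qed.

(** The geometric family has its own shift rule, so its coefficients are those of
    a theta series in y w. *)
Lemma geom_coef_rec j : geom_coef j = - (e2pi y * e2pi (j%:~R * tau) * geom_coef (j - 1)).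
Proof.
have h1 := has_sum_reindex addr1K subr1K (has_sum_expansion_coef absum_geom_term j).
have h2 := has_sumZ (- (e2pi y * e2pi (j%:~R * tau))) (has_sum_expansion_coef absum_geom_term (j - 1)).
rewrite -mulNr; apply: has_sum_unique h1 _; apply: has_sum_ext h2 => n /=.
rewrite quot_coef_succ /geom_term (_ : e2pi ((n + 1)%:~R * y) = e2pi y * e2pi (n%:~R * y)); first by ring.
by rewrite -e2piD; congr e2pi; rewrite rmorphD /=; ring.
Qed.

Lemma geom_coefE j : geom_coef j = theta_coef j * e2pi (j%:~R * y) * geom_coef 0.
Proof.
have c0 : theta_coef 0 = 1 by rewrite /theta_coef /tri !mul0r addr0 e2pi0.
have step i : theta_coef i * e2pi (i%:~R * y) = - (e2pi y * e2pi (i%:~R * tau) *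
    (theta_coef (i - 1) * e2pi ((i - 1)%:~R * y))).
  rewrite theta_coef_pred (_ : e2pi (i%:~R * y) = e2pi y * e2pi ((i - 1)%:~R * y)); first by ring.
  by rewrite -e2piD; congr e2pi; rewrite rmorphB /=; ring.
elim/int_rect: j => [|n ih|n ih].
- by rewrite c0 mul0r e2pi0 !mul1r.
- rewrite geom_coef_rec step (_ : n.+1%:Z - 1 = n) ?ih; last by lia.
  by ring.
- have := geom_coef_rec (- n%:Z); rewrite ih step (_ : - n%:Z - 1 = - n.+1%:Z); last by lia.
  rewrite mulNr => /oppr_inj e.
  have nz : e2pi y * e2pi ((- n%:Z)%:~R * tau) != 0 by rewrite mulf_neq0 ?e2pi_neq0.
  by apply: (mulfI nz); rewrite -e; ring.
Qed.

End Strip.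

Section TripleSum.
Variables x y w : C.
Hypothesis hy : 0 < complex.Im y < t.
Hypothesis hw : 0 < complex.Im w < t.

(** The summand of F up to a common factor.  The product of two quadrant signs is
    1 on both of the index sets of F and 0 elsewhere. *)
Definition triple_term (p : int * int * int) : C :=
  shifted_term x y p.1 *
    (quad_sign (p.1.1 - 1) p.2 * e2pi (p.2%:~R * (w + (degree p.1)%:~R * tau))).

Lemma triple_termE k l m : triple_term (k, l, m) =
  quad_sign (k - 1) l * quad_sign (k - 1) m * (theta_coef k * e2pi (k%:~R * x) *
    e2pi (l%:~R * y) * e2pi (m%:~R * w) * e2pi ((k * l + k * m + l * m)%:~R * tau)).
Proof.
rewrite /triple_term /shifted_term /beta /degree /=.
have -> : e2pi (m%:~R * (w + (k + l)%:~R * tau)) =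
   e2pi (m%:~R * w) * e2pi ((k * m + l * m)%:~R * tau).
  by rewrite -e2piD; congr e2pi; rewrite !(rmorphD, rmorphM) /=; ring.
have -> : e2pi (k%:~R * x + l%:~R * y + (k * l)%:~R * tau) =
   e2pi (k%:~R * x) * e2pi (l%:~R * y) * e2pi ((k * l)%:~R * tau) by rewrite !e2piD.
have -> : e2pi ((k * l + k * m + l * m)%:~R * tau) =
   e2pi ((k * l)%:~R * tau) * e2pi ((k * m + l * m)%:~R * tau).
  by rewrite -e2piD; congr e2pi; rewrite !(rmorphD, rmorphM) /=; ring.
ring.
Qed.

(** On the second index set l m >= -1 - l - m, which turns y^l w^m into
    (y/q)^l (w/q)^m up to the constant 1/|q|. *)
Lemma cabs_triple_term_le k l m : cabs (triple_term (k, l, m)) <=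
  rho (-1) * (cabs (theta_coef k * e2pi (k%:~R * x)) * decay y l * decay w m).
Proof.
rewrite triple_termE.
set K := theta_coef k * e2pi (k%:~R * x).
have nn : 0 <= rho (-1) * (cabs K * decay y l * decay w m).
  apply: mulr_ge0; first exact: ltW (rho_gt0 _).
  apply: mulr_ge0 (decay_ge0 _ _); exact: mulr_ge0 (cabs_ge0 _) (decay_ge0 _ _).
have ct (n : int) : cabs (e2pi (n%:~R * tau)) = rho n%:~R.
  by rewrite cabs_e2pi Im_intM.
have r1 : 1 <= rho (-1).
  have := @rho_le 0 (-1) (lerN10 _).
  by rewrite {1}/rho mul0r mulr0 oppr0 expR0.
rewrite /quad_sign; case: ifP => [/andP[k0 l0]|_]; last case: ifP => [/andP[k0 l0]|_].
- case: ifP => [/andP[_ m0]|_]; last first.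
    by rewrite ifF ?(mulr0, mul0r) ?cabs0 //; lia.
  rewrite !mul1r !cabsM -/K ct mulrC; apply: ler_pM.
  + exact: ltW (rho_gt0 _).
  + by rewrite !mulr_ge0 ?cabs_ge0.
  + apply: le_trans r1; apply: rho_le1; rewrite ler0z; nia.
  + rewrite -[cabs (theta_coef k) * _]cabsM -/K; apply: ler_pM; rewrite ?mulr_ge0 ?cabs_ge0 ?decay_pos //.
    by rewrite ler_wpM2l ?cabs_ge0 ?decay_pos.
- rewrite ifF; last by lia.
  case: ifP => [/andP[_ m0]|_]; last by rewrite ?(mulr0, mul0r) ?cabs0.
  rewrite mulrNN !mul1r.
  have -> : K * e2pi (l%:~R * y) * e2pi (m%:~R * w) * e2pi ((k * l + k * m + l * m)%:~R * tau)
     = e2pi ((k * l + k * m + (l * m + l + m))%:~R * tau) * (K *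
     e2pi (l%:~R * (y - tau)) * e2pi (m%:~R * (w - tau))).
    rewrite [RHS]mulrC -!(mulrA K) -!e2piD; congr (_ * e2pi _).
    rewrite !(rmorphD, rmorphM) /=; ring.
  rewrite [leLHS]cabsM ct; apply: ler_pM; rewrite ?cabs_ge0 ?(ltW (rho_gt0 _)) //.
    apply: rho_le; rewrite -(rmorphN1 intr) ler_int; nia.
  rewrite !cabsM; apply: ler_pM; rewrite ?mulr_ge0 ?cabs_ge0 ?decay_neg //.
  by rewrite ler_wpM2l ?mulr_ge0 ?cabs_ge0 ?decay_neg.
- by rewrite !mul0r cabs0.
Qed.

Lemma absum_triple_term : absum (fun p => cabs (triple_term p)).
Proof.
have h1 := absum_prod (fun k => cabs_ge0 _) (decay_ge0 y) (absum_theta x) (absum_decay hy).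
have h2 := absum_prod _ (decay_ge0 w) h1 (absum_decay hw).
have h3 := absumZ (ltW (rho_gt0 (-1))) (h2 _).
apply: absum_le (h3 _) => [[[k l] m]|[k l]]; first exact: cabs_triple_term_le.
by rewrite mulr_ge0 ?cabs_ge0 ?decay_ge0.
Qed.

Definition triple_sum := summability.sum triple_term.

(** For fixed k and l the sum over m is geometric, with ratio w q^(k+l). *)
Lemma triple_sum_rows :
  has_sum (fun p => shifted_term x y p / (1 - e2pi (w + (degree p)%:~R * tau))) triple_sum.
Proof.
apply: (has_sum_sigma (absum_sum absum_triple_term)) => -[k l] /=.
rewrite /triple_term /=; have [e|ns] := eqVneq (shifted_term x y (k, l)) 0.
  by rewrite [X in has_sum _ (X / _)]e mul0r; apply: has_sum_ext (@has_sum0 R int) => m; rewrite e mul0r.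
rewrite -[X in has_sum _ X]mulr1 mulrAC -mulrA -[_^-1]mul1r mulrCA [1 * (_ * _)]mul1r.
apply: has_sumZ; apply: quad_sign_geometric; rewrite ImD Im_intM /degree /=.
move: ns; rewrite /shifted_term /quad_sign /=; case/andP: hw => w0 wt.
case: ifP => [/andP[k0 l0] _|_].
  have : (0 : R) <= (k + l)%:~R by rewrite ler0z; lia.
  by rewrite k0 => h; nra.
case: ifP => [/andP[k0 l0] _|_]; last by rewrite mul0r eqxx.
rewrite ifF; last by lia.
have : ((k + l)%:~R : R) <= -1 by rewrite -[-1](rmorphN1 intr) ler_int; lia.
nra.
Qed.

(** The equation [shifted_coefE] gives the coefficients of Theta(w) S.  At x = 1/q
    its left-hand side vanishes for j = 0, which identifies the constant in
    [geom_coefE] as A(y, 1/q); then [theta_appell_opp_tau] and [reciprocity]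
    simplify Theta(y) A(y, 1/q) and Theta(y) A(y, x). *)
Lemma triple_sum_identity : tail_total != 0 ->
  (forall n : int, e2pi (x + n%:~R * tau) != 1) ->
  e2pi y * e2pi w * theta_series y * theta_series w * triple_sum =
  - (e2pi x * (tail_total * appell x (y + w) -
               e2pi x * theta_series x * appell x y * appell x w)).
Proof.
move=> J0 hx.
have hyn := strip_neq1 hy; have hwn := strip_neq1 hw.
have h := theta_expansion_sum (absum_shifted_term x hy) hwn; rewrite (has_sum_sum triple_sum_rows) in h.
have hA u : has_sum (fun n => theta_coef n * e2pi (n%:~R * u) / (1 - e2pi (x + n%:~R * tau))) (appell x u).
  exact: (@has_sum_quotient _ _ id (absum_theta_weight u) x hx (theta_series_neq0 J0 hx)).
(* the choice x = 1/q makes the left-hand side of the equation for j = 0 vanish *)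
have J1 : expansion_coef (geom_term y) id 0 = appell y (- tau).
  have := shifted_coefE (- tau) hy 0; rewrite add0r mul1r addNr e2pi0 subrr mul0r mul1r.
  have -> : theta_coef 0 = 1 by rewrite /theta_coef /tri !mul0r addr0 e2pi0.
  by rewrite mul1r => /esym/subr0_eq.
have hL j : expansion_coef (shifted_term x y) degree j = - (e2pi x * theta_coef (j + 1) / (1 - e2pi (x + (j + 1)%:~R * tau)) *
   (e2pi (j%:~R * y) * appell y (- tau) - appell y x)).
  have nz : 1 - e2pi (x + (j + 1)%:~R * tau) != 0 by rewrite subr_eq0 eq_sym.
  have hj := shifted_coefE x hy j; rewrite geom_coefE // J1 in hj.
  have e : e2pi x * theta_coef (j + 1) = - (e2pi (x + (j + 1)%:~R * tau) * theta_coef j).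
    by rewrite theta_coef_pred addrK e2piD; ring.
  rewrite e; apply: (mulfI nz); rewrite hj; field; exact: nz.
(* the coefficient of w^(n-1) on the left is a combination of the n-th terms of
   A(x, y w) and A(x, w) *)
have h1 := has_sum_reindex subr1K addr1K h.
have h2 := has_sumB (has_sumZ (e2pi (- y) * appell y (- tau)) (hA (y + w))) (has_sumZ (appell y x) (hA w)).
have h3 := has_sumZ (- (e2pi x * e2pi (- w))) h2.
have key : theta_series w * triple_sum = - (e2pi x * e2pi (- w)) *
   (e2pi (- y) * appell y (- tau) * appell x (y + w) - appell y x * appell x w).
  apply: has_sum_unique h1 _; apply: has_sum_ext h3 => n.
  rewrite hL subr1K.
  have -> : e2pi ((n - 1)%:~R * w) = e2pi (n%:~R * w) * e2pi (- w).
    by rewrite -e2piD; congr e2pi; rewrite rmorphB /=; ring.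
  have -> : e2pi ((n - 1)%:~R * y) = e2pi (n%:~R * y) * e2pi (- y).
    by rewrite -e2piD; congr e2pi; rewrite rmorphB /=; ring.
  have -> : e2pi (n%:~R * (y + w)) = e2pi (n%:~R * y) * e2pi (n%:~R * w).
    by rewrite -e2piD; congr e2pi; ring.
  by ring.
have e1 := theta_appell_opp_tau hyn; have e2 := reciprocity hx hyn.
rewrite -mulrA key !e2piN.
have y0 := e2pi_neq0 y; have w0 := e2pi_neq0 w.
transitivity (- (e2pi x * (theta_series y * appell y (- tau) * appell x (y + w) - (e2pi y * theta_series y * appell y x) * appell x w))).
  field; by rewrite y0 w0.
by rewrite e1 -e2; ring.
Qed.

End TripleSum.
End ThetaCore.

(** * The q-binomial theorem and a finite form of the Jacobi identity *)

Section QBinomial.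
Variables (K : fieldType) (q : K).
Hypothesis hq : forall n : nat, (0 < n)%N -> q ^+ n != 1.

Definition qfact (n : nat) : K := \prod_(i < n) (1 - q ^+ i.+1).

Lemma qfactS n : qfact n.+1 = qfact n * (1 - q ^+ n.+1).
Proof. by rewrite /qfact big_ord_recr. Qed.

Lemma qfact_neq0 n : qfact n != 0.
Proof.
elim: n => [|n ih]; first by rewrite /qfact big_ord0 oner_eq0.
by rewrite qfactS mulf_neq0 // subr_eq0 eq_sym hq.
Qed.

(** The Gaussian binomial coefficient, as a quotient of q-factorials. *)
Definition qbin (n k : nat) : K :=
  if (k <= n)%N then qfact n / (qfact k * qfact (n - k)) else 0.

Lemma qbin_gt n k : (n < k)%N -> qbin n k = 0.
Proof. by move=> h; rewrite /qbin leqNgt h. Qed.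

Lemma qbin0 n : qbin n 0 = 1.
Proof. by rewrite /qbin leq0n subn0 /qfact big_ord0 mul1r divff // (qfact_neq0 n). Qed.

Lemma qbinn n : qbin n n = 1.
Proof. by rewrite /qbin leqnn subnn {3}/qfact big_ord0 mulr1 divff // (qfact_neq0 n). Qed.

Lemma qbinS n k : (k <= n)%N ->
  qbin n.+1 k.+1 = qbin n k.+1 + q ^+ (n - k) * qbin n k.
Proof.
move=> kn; have [->|ne] := eqVneq k n.
  by rewrite !qbinn subnn expr0 /qbin ltnn add0r mul1r.
have {}kn : (k < n)%N by rewrite ltn_neqAle ne.
rewrite /qbin ltnS kn (ltnW kn) subSS.
have -> : (n - k = (n - k.+1).+1)%N by rewrite subnSK.
have := qfact_neq0 (n - k.+1); have := qfact_neq0 k; have := qfact_neq0 n.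
have h1 : 1 - q ^+ k.+1 != 0 by rewrite subr_eq0 eq_sym hq.
have h2 : 1 - q ^+ (n - k.+1).+1 != 0 by rewrite subr_eq0 eq_sym hq.
rewrite !qfactS; have -> : q ^+ n.+1 = q ^+ k.+1 * q ^+ (n - k.+1).+1.
  by rewrite -exprD; congr (_ ^+ _); rewrite subnSK //; lia.
by move=> a b d; field; rewrite ?h1 ?h2 ?a ?b ?d.
Qed.

Lemma qbinomial_theorem n k : (\prod_(i < n) (1 - (q ^+ i)%:P * 'X))`_k =
  (-1) ^+ k * q ^+ 'C(k, 2) * qbin n k.
Proof.
elim: n k => [|n ih] k.
  rewrite big_ord0 coef1 /qbin; case: k => [|k] //=; last by rewrite mulr0.
  by rewrite subnn /qfact !big_ord0 bin_small // !expr0 !(mulr1, invr1).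
rewrite big_ord_recr /= mulrBr mulr1 coefB mulrCA mulrC -mulrA coefMC mulrC mulrA.
rewrite coefMX ih; case: k => [|k] /=.
  by rewrite mulr0 subr0 !qbin0.
have [kn|nk] := leqP k n; last first.
  by rewrite ih !qbin_gt ?mulr0 ?subr0 // ltnS // ltnW.
rewrite ih qbinS // binS bin1 exprS exprD.
have -> : q ^+ n = q ^+ k * q ^+ (n - k) by rewrite -exprD subnKC.
by ring.
Qed.

(** The product of the 1 - q^i X for i <= 2n vanishes at X = q^(-n).  Its derivative
    there, computed from the factors, is a product of two q-factorials; computed
    from the q-binomial coefficients, it is the sum on the left, where the shift
    by n is free because the value at that point is zero. *)
Lemma finite_jacobi n : q != 0 ->
  \sum_(k < (n.*2.+1).+1) (k%:R - n%:R) * ((-1) ^+ k * q ^+ 'C(k, 2) * qbin n.*2.+1 k) *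
    (q ^- n) ^+ k = - \prod_(i < n) (1 - q ^- i.+1) * qfact n.
Proof.
move=> q0.
pose P : {poly K} := \prod_(i < n.*2.+1) (1 - (q ^+ i)%:P * 'X).
have sP : (size P <= (n.*2.+1).+1)%N.
  apply/leq_sizeP => j hj; rewrite qbinomial_theorem /qbin leqNgt hj mulr0 //.
have nlt : (n < n.*2.+1)%N by rewrite -addnn; lia.
pose i0 := Ordinal nlt.
have PE : P = (1 - (q ^+ n)%:P * 'X) * \prod_(i < n.*2.+1 | i != i0) (1 - (q ^+ i)%:P * 'X).
  by rewrite /P (bigD1 i0).
set Q := \prod_(i < _ | _) _ in PE.
have root : P.[q ^- n] = 0.
  by rewrite PE !hornerE /= mulfV ?expf_neq0 // subrr mul0r.
have drv : P^`().[q ^- n] = - q ^+ n * Q.[q ^- n].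
  rewrite PE derivM !hornerE /= mulfV ?expf_neq0 // subrr mul0r addr0.
  by rewrite derivB derivC derivM derivC derivX !hornerE /=; ring.
have QE : Q.[q ^- n] = \prod_(i < n) (1 - q ^- i.+1) * qfact n.
  rewrite /Q horner_prod.
  have -> : \prod_(i < n.*2.+1 | i != i0) (1 - (q ^+ i)%:P * 'X).[q ^- n] =
     \prod_(0 <= i < n.*2.+1 | i != n) (1 - q ^+ i * q ^- n).
    by rewrite big_mkord; apply: eq_big => [i|i _]; rewrite ?hornerE //.
  rewrite (big_cat_nat _ (n := n)) //=; last by rewrite ltnW.
  congr (_ * _).
    rewrite big_mkord (_ : bigop _ _ _ = \prod_(i < n) (1 - q ^+ i / q ^+ n)); last first.
      by apply: eq_bigl => i; apply/eqP; move: (ltn_ord i); lia.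
    rewrite (reindex_inj rev_ord_inj) /=; apply: eq_bigr => i _; congr (1 - _).
    by rewrite -[in X in _ / X](subnK (ltn_ord i)) exprD invfM mulrA mulfV ?mul1r ?expf_neq0.
  rewrite big_ltn_cond // eqxx /= -[n.+1]add0n big_addn (_ : n.*2.+1 - n.+1 = n)%N; last first.
    by rewrite -addnn; lia.
  rewrite big_mkord; under eq_bigl => i do rewrite (gtn_eqF (leq_addl i n.+1)).
  apply: eq_bigr => i _; congr (1 - _).
  by rewrite -addSnnS exprD mulfK ?expf_neq0.
pose p k := (-1) ^+ k * q ^+ 'C(k, 2) * qbin n.*2.+1 k.
have e0 : \sum_(k < (n.*2.+1).+1) p k * (q ^- n) ^+ k = 0.
  transitivity P.[q ^- n] => //; rewrite (horner_coef_wide _ sP); apply: eq_bigr => k _.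
  by rewrite qbinomial_theorem.
have e1 : \sum_(k < (n.*2.+1).+1) k%:R * p k * (q ^- n) ^+ k = q ^- n * P^`().[q ^- n].
  have sP' : (size P^`() <= n.*2.+1)%N.
    by apply: leq_trans (size_poly _ _) _; move: sP; case: (size P).
  rewrite big_ord_recl /= !mul0r add0r (horner_coef_wide _ sP') mulr_sumr.
  apply: eq_bigr => k _; rewrite coef_deriv qbinomial_theorem /bump /= add1n exprS -[_ *+ _]mulr_natl /p.
  by rewrite mulr1; ring.
(* the q^(-n) that converts q^(-n)^(k-1) into q^(-n)^k cancels the one in the derivative *)
transitivity (\sum_(k < (n.*2.+1).+1) k%:R * p k * (q ^- n) ^+ k -
   n%:R * \sum_(k < (n.*2.+1).+1) p k * (q ^- n) ^+ k).
  rewrite mulr_sumr -sumrB; apply: eq_bigr => k _; rewrite /p; ring.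
rewrite e0 mulr0 subr0 e1 drv QE !mulNr mulrN mulrA mulVf ?expf_neq0 // mul1r //.
Qed.

End QBinomial.

(** * The Euler product *)

Section EulerProduct.
Variable R : realType.
Local Notation C := (cplx R).

Variable q : C.
Hypothesis q0 : q != 0.
Hypothesis q1 : cabs q < 1.
Local Notation r := (cabs q).

Lemma cabsX (z : C) n : cabs (z ^+ n) = cabs z ^+ n.
Proof. by elim: n => [|n ih]; rewrite ?expr0 ?cabs1 // !exprS cabsM ih. Qed.

Lemma q_not_root n : (0 < n)%N -> q ^+ n != 1.
Proof.
move=> n0; apply/eqP => /(congr1 (@cabs R)); rewrite cabsX cabs1 => h.
by have := exprn_ilt1 n (cabs_ge0 q) q1; rewrite h ltxx -lt0n n0.
Qed.

Lemma geometric_le n : \sum_(i < n) r ^+ i <= (1 - r)^-1.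
Proof.
have sr : 0 < 1 - r by rewrite subr_gt0.
rewrite -[_^-1]div1r ler_pdivlMr // mulrC -opprB mulNr -subrX1 opprB.
by rewrite lerBlDr lerDl exprn_ge0 ?cabs_ge0.
Qed.

Lemma qfact_le n : cabs (qfact q n) <= expR (1 - r)^-1.
Proof.
apply: (@le_trans _ _ (expR (\sum_(i < n) r ^+ i))); last by rewrite ler_expR geometric_le.
rewrite expR_sum /qfact; elim: n => [|n ih]; first by rewrite !big_ord0 cabs1.
rewrite !big_ord_recr cabsM ler_pM ?cabs_ge0 //.
apply: le_trans (cabsD _ _) _; rewrite cabs1 cabsN cabsX.
apply: le_trans (expR_ge1Dx _); rewrite lerD2l exprS ler_piMl ?exprn_ge0 ?cabs_ge0 ?ltW //.
Qed.

(** The elementary bound 1 - a >= exp (- a / (1 - a)) keeps the Euler product away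
    from zero. *)
Lemma qfact_ge n : expR (- (1 - r)^-1 ^+ 2) <= cabs (qfact q n).
Proof.
have sr : 0 < 1 - r by rewrite subr_gt0.
apply: (@le_trans _ _ (expR (\sum_(i < n) - ((1 - r)^-1 * r ^+ i)))).
  rewrite ler_expR sumrN lerN2 -mulr_sumr expr2 ler_wpM2l ?geometric_le //.
  by rewrite invr_ge0 ltW.
rewrite expR_sum /qfact; elim: n => [|n ih]; first by rewrite !big_ord0 cabs1.
rewrite !big_ord_recr cabsM ler_pM ?expR_ge0 ?cabs_ge0 //.
  by rewrite prodr_ge0 // => i _; exact: expR_ge0.
set a := r ^+ n.+1; have a0 : 0 <= a by rewrite exprn_ge0 ?cabs_ge0.
have ar : a <= r by rewrite /a exprS ler_piMr ?cabs_ge0 // exprn_ile1 ?cabs_ge0 // ltW.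
have a1 : 0 < 1 - a by lra.
have h1 : 1 - a <= cabs (1 - q ^+ n.+1).
  have := cabsD (1 - q ^+ n.+1) (q ^+ n.+1); rewrite subrK cabs1 cabsX -/a; lra.
apply: le_trans h1; rewrite expRN invf_ple ?posrE ?expR_gt0 //.
apply: le_trans (expR_ge1Dx _).
have -> : (1 - a)^-1 = 1 + a / (1 - a) by field; rewrite gt_eqF.
rewrite lerD2l mulrC ler_pM ?invr_ge0 ?(ltW a1) //.
  by rewrite lef_pV2 ?posrE //; lra.
by rewrite /a exprS ler_piMl ?exprn_ge0 ?cabs_ge0 ?ltW.
Qed.

(** The increments - (q)_n q^(n+1) of (q)_n are absolutely summable. *)
Lemma qfact_cvg : exists2 Q : C, Q != 0 & (qfact q n @[n --> \oo] --> Q)%classic.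
Proof.
have h : absum (fun n => cabs (qfact q n * q ^+ n.+1)).
  have K0 : 0 <= expR (1 - r)^-1 by exact: expR_ge0.
  have g : absum (fun n : nat => r ^+ n) by apply: absum_geom; rewrite cabs_ge0.
  apply: absum_le (absumZ K0 g) => n.
  rewrite cabsM cabsX ler_pM ?cabs_ge0 ?exprn_ge0 ?qfact_le ?cabs_ge0 //.
  by rewrite exprS ler_piMl ?exprn_ge0 ?cabs_ge0 ?ltW.
have [s hs] := absum_has_sum h.
have hQ : (qfact q n @[n --> \oo] --> 1 - s)%classic.
  have e n : qfact q n = 1 - \sum_(i < n) qfact q i * q ^+ i.+1.
    elim: n => [|n ih]; first by rewrite big_ord0 subr0 /qfact big_ord0.
    rewrite big_ord_recr /= opprD addrA -ih qfactS; ring.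
  apply/cvg_cabsP => d d0; move/cvg_cabsP: (has_sum_nat_cvg hs) => /(_ d d0).
  apply: filterS => n; rewrite e cabsB; congr (cabs _ < _); ring.
exists (1 - s) => //; apply/eqP => e; rewrite e in hQ.
move/cvg_cabsP: hQ => /(_ _ (expR_gt0 (- (1 - r)^-1 ^+ 2)))[N _ /(_ N (leqnn N))] /=.
by rewrite subr0 ltNge qfact_ge.
Qed.

End EulerProduct.

(** * The Jacobi identity for the cube of eta *)

Section Jacobi.
Variable R : realType.
Local Notation C := (cplx R).
Variable tau : C.
Hypothesis htau : 0 < complex.Im tau.
Local Notation q := (e2pi tau).
Local Notation c := (theta_coef tau).
Local Notation theta_tail := (theta_tail tau).

Lemma e2pi_natM (n : nat) (z : C) : e2pi (n%:R * z) = e2pi z ^+ n.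
Proof. by have := e2pi_intM n z; rewrite -exprnP. Qed.

Lemma cabs_nome_lt1 : cabs q < 1.
Proof. by rewrite cabs_e2pi expR_lt1 oppr_lt0 mulr_gt0 // two_pi_gt0. Qed.

Lemma absum_int_theta_coef : absum (fun n : int => `|n|%:~R * cabs (c n)).
Proof.
have a0 : 0 < 2 * pi * complex.Im tau / 2 :> R by rewrite divr_gt0 // mulr_gt0 // two_pi_gt0.
set a := _ / _ in a0.
have h := absumD (@absum_expR_quad R _ (1 - a) 0 a0) (@absum_expR_quad R _ (- 1 - a) 0 a0).
apply: absum_le h => n; rewrite cabs_theta_coef /rho /tri.
have -> : - (2 * pi * (n%:~R * (n%:~R + 1) / 2 * complex.Im tau)) =
   - (a * n%:~R ^+ 2) - a * n%:~R :> R by rewrite /a; field.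
set x : R := n%:~R; have -> : `|n|%:~R = `|x| :> R by rewrite /x intr_norm.
have -> : - (a * x ^+ 2) + (1 - a) * x + 0 = x + (- (a * x ^+ 2) - a * x) by ring.
have -> : - (a * x ^+ 2) + (- 1 - a) * x + 0 = - x + (- (a * x ^+ 2) - a * x) by ring.
rewrite [expR (x + _)]expRD [expR (- x + _)]expRD -mulrDl ler_wpM2r ?expR_ge0 //.
have h1 := expR_ge1Dx x; have h2 := expR_ge1Dx (- x).
have h3 := expR_ge0 x; have h4 := expR_ge0 (- x).
by rewrite ler_norml; apply/andP; split; lra.
Qed.

(** Centring the index at n makes the exponent of q quadratic in k - n, up to a
    factor that depends only on n. *)
Lemma theta_coef_nat (n k : nat) : (-1) ^+ k * q ^+ 'C(k, 2) * (q ^- n) ^+ k =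
  - c (k%:Z - n%:Z - 1) * ((-1) ^+ n * q ^- 'C(n.+1, 2)).
Proof.
have tri2 (m : nat) : 'C(m.+1, 2)%:R = m%:R * (m%:R + 1) / 2 :> C.
  elim: m => [|m ih]; first by rewrite mul0r mul0r.
  by rewrite binS bin1 natrD ih -[m.+1]addn1 natrD; field.
have tri2' (m : nat) : 'C(m, 2)%:R = m%:R * (m%:R - 1) / 2 :> C.
  case: m => [|m]; first by rewrite mul0r mul0r.
  by rewrite tri2 -[m.+1]addn1 natrD; field.
have neg1 (m : nat) : (-1) ^+ m = e2pi (m%:R * (1 / 2)) :> C by rewrite e2pi_natM e2pi_1_2.
rewrite !neg1 -[q ^+ 'C(k, 2)]e2pi_natM -[q ^+ n]e2pi_natM -[q ^+ 'C(n.+1, 2)]e2pi_natM.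
rewrite -!e2piN -e2pi_natM /theta_coef oppr_e2pi -!e2piD; congr e2pi.
by rewrite tri2 tri2' /tri !(rmorphB, rmorph1) /= -!pmulrn; field.
Qed.

(** The terms of [finite_jacobi] after centring, so that their limit as n grows is
    visible; the range of [r] is that of the q-binomial coefficient. *)
Definition jacobi_term (n : nat) (r : int) : C :=
  if (- n%:Z <= r) && (r <= n.+1%:Z) then
    r%:~R * c (r - 1) * qbin q n.*2.+1 (absz (n%:Z + r)) else 0.

Lemma nome_not_root (n : nat) : (0 < n)%N -> q ^+ n != 1.
Proof. exact: (q_not_root cabs_nome_lt1). Qed.

Lemma qfact_inv (n : nat) : \prod_(i < n) (1 - q ^- i.+1) =
  (-1) ^+ n * q ^- 'C(n.+1, 2) * qfact q n.
Proof.
have q0 : q != 0 := e2pi_neq0 tau.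
elim: n => [|n ih]; first by rewrite /qfact !big_ord0 expr0 bin_small // expr0 invr1 !mulr1.
rewrite big_ord_recr /= ih qfactS [in 'C(n.+2, 2)]binS bin1 exprD [(-1) ^+ n.+1]exprS; field.
by rewrite !expf_neq0.
Qed.

Lemma jacobi_term_sum (n : nat) : has_sum (jacobi_term n) (qfact q n ^+ 2).
Proof.
have q0 : q != 0 := e2pi_neq0 tau.
have := @finite_jacobi _ q nome_not_root n q0; rewrite qfact_inv => hj.
pose s : seq int := [seq k%:Z - n%:Z | k <- index_iota 0 n.*2.+2].
have -> : qfact q n ^+ 2 = \sum_(r <- s) jacobi_term n r.
  rewrite big_map big_mkord.
  have nz : (-1) ^+ n * q ^- 'C(n.+1, 2) != 0 :> C.
    by rewrite mulf_neq0 ?invr_neq0 ?expf_neq0 // oppr_eq0 oner_eq0.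
  apply: (mulfI nz); rewrite mulr_sumr.
  transitivity (- (- ((-1) ^+ n / q ^+ 'C(n.+1, 2) * qfact q n) * qfact q n)); first by ring.
  rewrite -hj -sumrN; apply: eq_bigr => k _.
  have -> : jacobi_term n (k%:Z - n%:Z) = (k%:R - n%:R) * c (k%:Z - n%:Z - 1) * qbin q n.*2.+1 k.
    rewrite /jacobi_term ifT; last by have := ltn_ord k; lia.
    congr (_ * _ * qbin _ _ _); first by rewrite rmorphB /= -!pmulrn.
    lia.
  transitivity (- ((k%:R - n%:R) * qbin q n.*2.+1 k * ((-1) ^+ k * q ^+ 'C(k, 2) * (q ^- n) ^+ k))).
    by ring.
  by rewrite theta_coef_nat; ring.
apply: has_sum_finite.
  by rewrite map_inj_uniq ?iota_uniq // => i j /addIr [].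
move=> r hr; rewrite /jacobi_term; case: ifP => // /andP[r1 r2]; case/negP: hr.
apply/mapP; exists (absz (n%:Z + r)); last by lia.
rewrite mem_index_iota; lia.
Qed.

(** Summation by parts: the theta coefficients are the differences of the tails. *)
Lemma abel_sum : has_sum (fun r : int => r%:~R * c (r - 1)) (- tail_total tau).
Proof.
have [M M0 hM] := theta_tail_bound htau.
have ab : absum (fun r : int => cabs (r%:~R * theta_tail (r - 1))).
  have hK := absumZ M0 (absumD (absum_inj (addIr (-1)) _ absum_int_theta_coef)
    (absum_inj (addIr (-1)) _ (absum_theta_coef htau))).
  apply: absum_le (hK _ _) => [r|r|r]; rewrite ?mulr_ge0 ?cabs_ge0 ?ler0z //.
  have -> : cabs (r%:~R * theta_tail (r - 1)) = `|r|%:~R * cabs (theta_tail (r - 1)).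
    rewrite cabsM; congr (_ * _); rewrite -(rmorph_int (real_complex R)) /= cabs_real.
    by rewrite intr_norm.
  rewrite -[X in _ <= M * (_ + X)]mul1r -mulrDl mulrCA.
  rewrite cabs_theta_coef; apply: ler_pM; rewrite ?ler0z ?cabs_ge0 //.
    by rewrite -[1]/(1%:~R) -rmorphD /= ler_int; lia.
  exact: (hM _).1.
have h := absum_sum ab; set U := summability.sum _ in h.
have h2 := has_sum_reindex subr1K addr1K h.
have hJ := has_sum_reindex subr1K addr1K (has_sum_reindex subr1K addr1K (has_sum_tail htau)).
have := has_sumB h (has_sumD h2 hJ).
rewrite opprD addrA subrr sub0r; apply: has_sum_ext => r.
rewrite -theta_tail_rec // rmorphB /=; ring.
Qed.

Lemma jacobi_term_le n r : cabs (jacobi_term n r) <= `|r|%:~R * cabs (c (r - 1)) *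
  (expR (1 - cabs q)^-1 * (expR ((1 - cabs q)^-1 ^+ 2)) ^+ 2).
Proof.
rewrite /jacobi_term; case: ifP => _; last first.
  by rewrite cabs0 !mulr_ge0 ?ler0z ?cabs_ge0 ?expR_ge0 ?exprn_ge0 ?expR_ge0.
rewrite cabsM; apply: ler_pM; rewrite ?cabs_ge0 //.
  rewrite cabsM -(rmorph_int (real_complex R)) /= cabs_real intr_norm.
  by [].
rewrite /qbin; case: ifP => _; last by rewrite cabs0 mulr_ge0 ?exprn_ge0 ?expR_ge0.
rewrite cabsM cabsV cabsM; apply: ler_pM; rewrite ?cabs_ge0 ?invr_ge0 ?mulr_ge0 ?cabs_ge0 //.
  exact: (qfact_le cabs_nome_lt1).
rewrite invfM expr2; have hV m : (cabs (qfact q m))^-1 <= expR ((1 - cabs q)^-1 ^+ 2).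
  have h := qfact_ge cabs_nome_lt1 m.
  rewrite -[leRHS]invrK -expRN lef_pV2 ?posrE ?expR_gt0 //.
  exact: lt_le_trans (expR_gt0 _) h.
by apply: ler_pM; rewrite ?invr_ge0 ?cabs_ge0.
Qed.

Lemma cvg_ratio (f g h : nat -> C) (a : C) : a != 0 ->
  (f n @[n --> \oo] --> a)%classic -> (g n @[n --> \oo] --> a)%classic ->
  (h n @[n --> \oo] --> a)%classic ->
  (f n * (g n * h n)^-1 @[n --> \oo] --> a * (a * a)^-1)%classic.
Proof.
move=> a0 hf hg hh; apply: cvgM hf _; apply: cvgV; first by rewrite mulf_neq0.
exact: cvgM.
Qed.

Lemma jacobi_term_cvg (Q : C) : Q != 0 -> (qfact q n @[n --> \oo] --> Q)%classic ->
  forall r : int, (jacobi_term n r @[n --> \oo] --> Q^-1 * (r%:~R * c (r - 1)))%classic.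
Proof.
move=> Q0 hQ r.
have h1 : (qfact q n.*2.+1 @[n --> \oo] --> Q)%classic.
  apply: (cvg_comp _ _ _ hQ); apply/cvgnyPge => A; exists A => // n /=; lia.
have h2 : (qfact q (absz (n%:Z + r)) @[n --> \oo] --> Q)%classic.
  apply: (cvg_comp _ _ _ hQ); apply/cvgnyPge => A; exists (A + absz r)%N => // n /=; lia.
have h3 : (qfact q (n.*2.+1 - absz (n%:Z + r)) @[n --> \oo] --> Q)%classic.
  apply: (cvg_comp _ _ _ hQ); apply/cvgnyPge => A; exists (A + absz r)%N => // n /=; lia.
have h5 : (r%:~R * c (r - 1) * (qfact q n.*2.+1 *
    (qfact q (absz (n%:Z + r)) * qfact q (n.*2.+1 - absz (n%:Z + r)))^-1) @[n --> \oo] -->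
    r%:~R * c (r - 1) * (Q * (Q * Q)^-1))%classic.
  by apply: cvgM; [exact: cvg_cst|exact: cvg_ratio].
have e : r%:~R * c (r - 1) * (Q * (Q * Q)^-1) = Q^-1 * (r%:~R * c (r - 1)).
  by field.
rewrite -e; apply: cvg_trans h5; apply: near_eq_cvg.
exists (absz r) => // n /= hn; rewrite /jacobi_term ifT; last by lia.
rewrite /qbin ifT //; lia.
Qed.

(** Let n tend to infinity in the finite identity: the q-binomial coefficients tend
    to the inverse of the Euler product and are bounded, so dominated convergence
    applies.  This is Jacobi's identity (q)^3 = sum_(n >= 0) (-1)^n (2n+1) q^(n(n+1)/2). *)
Lemma tail_total_eta (Q : C) : Q != 0 -> (qfact q n @[n --> \oo] --> Q)%classic ->
  tail_total tau = - Q ^+ 3.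
Proof.
move=> Q0 hQ.
pose K : R := expR (1 - cabs q)^-1 * (expR ((1 - cabs q)^-1 ^+ 2)) ^+ 2.
have K0 : 0 <= K by rewrite mulr_ge0 ?exprn_ge0 ?expR_ge0.
have hg : absum (fun r : int => `|r|%:~R * cabs (c (r - 1)) * K).
  have hK := absumZ K0 (absumD (absum_inj (addIr (-1)) _ absum_int_theta_coef)
    (absum_inj (addIr (-1)) _ (absum_theta_coef htau))).
  apply: absum_le (hK _ _) => [r|r|r]; rewrite ?mulr_ge0 ?cabs_ge0 ?ler0z //.
  rewrite mulrC ler_wpM2l // -[X in _ <= (_ + X)]mul1r -mulrDl ler_wpM2r ?cabs_ge0 //.
  by rewrite -[1]/(1%:~R) -rmorphD /= ler_int; lia.
have hlim := has_sumZ Q^-1 abel_sum.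
have conv r e : 0 < e ->
    \forall n \near \oo, cabs (jacobi_term n r - Q^-1 * (r%:~R * c (r - 1))) < e.
  by move/cvg_cabsP: (jacobi_term_cvg Q0 hQ (r := r)); apply.
have hbd : \forall n \near \oo, forall r, cabs (jacobi_term n r) <= `|r|%:~R * cabs (c (r - 1)) * K.
  by apply: nearW => n r; exact: jacobi_term_le.
have hbd0 r : cabs (Q^-1 * (r%:~R * c (r - 1))) <= `|r|%:~R * cabs (c (r - 1)) * K.
  apply/ler_addgt0Pr => e e0; have [N _ /(_ N (leqnn N)) /= h] := conv r e e0.
  rewrite -(subKr (jacobi_term N r) (_ * _)); apply: le_trans (cabsD _ _) _.
  rewrite cabsN lerD ?jacobi_term_le // ltW //.
have hs : \forall n \near \oo, has_sum (jacobi_term n) (qfact q n ^+ 2).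
  by apply: nearW => n; exact: jacobi_term_sum.
have lim2 := has_sum_dominated _ hg hbd hbd0 conv hs hlim.
have lim1 : (qfact q n ^+ 2 @[n --> \oo] --> Q ^+ 2)%classic by rewrite expr2; exact: cvgM.
have e : Q ^+ 2 = Q^-1 * - tail_total tau.
  have lim3 : (qfact q n ^+ 2 @[n --> \oo] --> Q^-1 * - tail_total tau)%classic.
    by apply/cvg_cabsP; exact: lim2.
  exact: seq_cvg_unique lim1 lim3.
have : Q * Q ^+ 2 = - tail_total tau by rewrite e mulVKf.
by rewrite -exprS => ->; rewrite opprK.
Qed.

End Jacobi.

(** * Back to theta, mu, eta and F *)

Section Classical.
Variable R : realType.
Local Notation C := (cplx R).
Variable tau : C.
Hypothesis htau : 0 < complex.Im tau.
Local Notation t := (complex.Im tau).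
Local Notation P := (2 * pi : R).

Lemma e2pi_1_4 : e2pi (1 / 4 : C) = 'i%C.
Proof.
have -> : (1 / 4 : C) = ((1 / 4 : R)%:C)%C by rewrite rmorphM fmorphV rmorph1 rmorph_nat.
rewrite e2pi_polar /= mulr0 oppr0 expR0 mul1r.
rewrite (_ : 2 * pi / 4 = pi / 2); last by field.
by rewrite mul1r cos_pihalf sin_pihalf.
Qed.

Lemma cexp_e2pi (a b : C) : cexp (two_pi_i R * a * b) = e2pi (a * b).
Proof. by rewrite e2piE /zeta mulrA. Qed.

Lemma thetaE (z : C) : theta z tau =
  e2pi (tau / 8) * e2pi (z / 2) * 'i%C * theta_series tau z.
Proof.
rewrite /theta /sum_on; apply: has_sum_sum.
have h := has_sumZ (e2pi (tau / 8) * e2pi (z / 2) * 'i%C) (has_sum_theta htau z).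
apply: has_sum_ext h => n /=.
rewrite -e2pi_1_4 qpowE cexp_e2pi.
rewrite /theta_coef -!e2piD; congr e2pi.
rewrite !(rmorphM, fmorphV, rmorphD, rmorphXn, rmorph1, ratr_int, ratr_nat) /= /tri.
by field.
Qed.

Lemma muE (z1 z2 : C) : mu z1 z2 tau = e2pi (z1 / 2) / theta z2 tau * appell tau z1 z2.
Proof.
rewrite /mu /appell zeta_halfE /sum_on; congr (_ * _); congr summability.sum; apply/funext => n /=.
rewrite -!e2piE oppr_e2pi -e2pi_intM !qpowE -!e2piD ratr_int; congr (_ / _).
rewrite /theta_coef; congr e2pi.
rewrite !(rmorphM, fmorphV, rmorphD, rmorph1, ratr_int, ratr_nat) /= /tri.
by field.
Qed.

Lemma etaE (Q : C) : (qfact (e2pi tau) n @[n --> \oo] --> Q) ->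
  dedekind_eta tau = e2pi (tau / 24) * Q.
Proof.
move=> hQ; rewrite /dedekind_eta qpowE; congr (e2pi _ * _).
  by rewrite rmorphM fmorphV rmorph1 /= ratr_nat mul1r mulrC.
apply: cvg_lim => //; apply: cvg_trans hQ; apply: near_eq_cvg; apply: nearW => n.
rewrite big_add1 /= big_mkord /qfact; apply: eq_bigr => i _.
by rewrite qpowE ratr_nat e2pi_natM.
Qed.

Definition pos_index (x : int * int * int) : bool :=
  let: (k, l, m) := x in [&& 0 < k, 0 <= l & 0 <= m].
Definition neg_index (x : int * int * int) : bool :=
  let: (k, l, m) := x in [&& k <= 0, l < 0 & m < 0].

Lemma F_termE (z1 z2 z3 : C) k l m : F_term z1 z2 z3 tau (k, l, m) =
  theta_coef tau k * e2pi (k%:~R * z1) * e2pi (l%:~R * z2) * e2pi (m%:~R * z3) *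
  e2pi ((k * l + k * m + l * m)%:~R * tau).
Proof.
rewrite /F_term -!e2piE -!e2pi_intM -e2pi_half_int qpowE /theta_coef -!e2piD; congr e2pi.
rewrite !(rmorphM, fmorphV, rmorphD, rmorph1, ratr_int, ratr_nat) /= /tri.
by field.
Qed.

Lemma triple_term_split (z1 z2 z3 : C) (x : int * int * int) : triple_term tau z1 z2 z3 x =
  (if pos_index x then F_term z1 z2 z3 tau x else 0) +
  (if neg_index x then F_term z1 z2 z3 tau x else 0).
Proof.
case: x => [[k l] m]; rewrite triple_termE // F_termE /pos_index /neg_index /quad_sign.
set v := (X in _ * X).
have -> : (0 <= k - 1) = (0 < k) by lia.
have -> : (k - 1 < 0) = (k <= 0) by lia.
case: (ltP 0 k) => k0 /=; case: (leP 0 l) => l0 /=; case: (leP 0 m) => m0 /=;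
  rewrite ?mulrNN ?(mul1r, mul0r, mulr0, addr0, add0r) //.
Qed.

Lemma F_triple_sum (z1 z2 z3 : C) : 0 < complex.Im z2 < t -> 0 < complex.Im z3 < t ->
  F z1 z2 z3 tau = e2pi (- (tau / 8) - z1 / 2 + z2 / 2 + z3 / 2) * triple_sum tau z1 z2 z3.
Proof.
move=> h2 h3; rewrite /F.
have hf := absum_triple_term htau z1 h2 h3.
have hpos : has_sum (fun x => if pos_index x then F_term z1 z2 z3 tau x else 0)
   (sum_on pos_index (F_term z1 z2 z3 tau)).
  apply: absum_sum; apply: absum_le hf => x; rewrite triple_term_split.
  case: x => [[k l] m]; rewrite /pos_index /neg_index.
  case: ifP => hp; last by rewrite cabs0 cabs_ge0.
  by rewrite ifF ?addr0 //; lia.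
have hneg : has_sum (fun x => if neg_index x then F_term z1 z2 z3 tau x else 0)
   (sum_on neg_index (F_term z1 z2 z3 tau)).
  apply: absum_sum; apply: absum_le hf => x; rewrite triple_term_split.
  case: x => [[k l] m]; rewrite /pos_index /neg_index.
  case: (ifP [&& k <= 0, _ & _]) => hp; last by rewrite cabs0 cabs_ge0.
  by rewrite ifF ?add0r //; lia.
have -> : triple_sum tau z1 z2 z3 = sum_on pos_index (F_term z1 z2 z3 tau) +
    sum_on neg_index (F_term z1 z2 z3 tau).
  apply: has_sum_sum; apply: has_sum_ext (has_sumD hpos hneg) => x.
  by rewrite triple_term_split.
congr (_ * (_ + _)).
rewrite !zeta_halfE qpowE -e2piN -!e2piD; congr e2pi.
by rewrite rmorphN rmorphM fmorphV rmorph1 /= ratr_nat; field.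
Qed.

Lemma not_lattice (z : C) : ~ lattice tau z -> forall n : int, e2pi (z + n%:~R * tau) != 1.
Proof.
move=> h n; apply/eqP => /e2pi_eq1[m e]; apply: h; exists (- n), m.
by rewrite rmorphN -e; ring.
Qed.

(** Away from the poles the statement is [triple_sum_identity] after division by
    theta values, which are nonzero. *)
Lemma F_eq_rhs (z1 z2 z3 : C) : 0 < complex.Im z2 < t -> 0 < complex.Im z3 < t ->
  F_rhs_dom tau (z1, z2, z3) -> F_rhs tau (z1, z2, z3) = F z1 z2 z3 tau.
Proof.
move=> h2 h3 [/not_lattice n1 /not_lattice n2 /not_lattice n3 /not_lattice n23].
have [Q Q0 hQ] := qfact_cvg (cabs_nome_lt1 htau).
have hJ := tail_total_eta htau Q0 hQ.
have J0 : tail_total tau != 0 by rewrite hJ oppr_eq0 expf_neq0.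
have T2 := theta_series_neq0 htau J0 n2; have T3 := theta_series_neq0 htau J0 n3.
have T23 := theta_series_neq0 htau J0 n23.
have id := triple_sum_identity htau h2 h3 J0 n1.
rewrite F_triple_sum // /F_rhs !muE !thetaE (etaE hQ).
have eE (z : C) : e2pi z = e2pi (z / 2) ^+ 2 by rewrite -e2pi_natM; congr e2pi; field.
have e8 : e2pi (tau / 24) ^+ 3 = e2pi (tau / 8) by rewrite -e2pi_natM; congr e2pi; field.
have i2 : ('i%C : C) ^+ 2 = -1 by exact: sqr_i.
have i0 : 'i%C != 0 :> C by rewrite -e2pi_1_4 e2pi_neq0.
rewrite (e2piD _ (z3 / 2)) (e2piD _ (z2 / 2)) e2piB e2piN.
rewrite [(z2 + z3) / 2]mulrDl e2piD exprMn e8.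
rewrite (eE z1) (eE z2) (eE z3) hJ in id.
have a8 := e2pi_neq0 (tau / 8); have a1 := e2pi_neq0 (z1 / 2).
have a2 := e2pi_neq0 (z2 / 2); have a3 := e2pi_neq0 (z3 / 2).
move: (e2pi (tau / 8)) (e2pi (z1 / 2)) (e2pi (z2 / 2)) (e2pi (z3 / 2)) a8 a1 a2 a3 id.
move: (theta_series tau z1) (theta_series tau z2) (theta_series tau z3) (theta_series tau (z2 + z3)) T2 T3 T23.
move: (appell tau z1 z2) (appell tau z1 z3) (appell tau z1 (z2 + z3)) (triple_sum tau z1 z2 z3) => A2 A3 A23 Sv.
move=> T1 t2 t3 t23 T2 T3 T23 e1 x y w ne1 nx ny nw id.
have -> : Sv = (- (x ^+ 2 * (- Q ^+ 3 * A23 - x ^+ 2 * T1 * A2 * A3))) /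
    (y ^+ 2 * w ^+ 2 * t2 * t3).
  by rewrite -id; field; rewrite T2 T3 ny nw.
move: i2 i0; move: ('i%C : C) => I i2 i0.
(* a common form of both sides: the left-hand side equals it for every nonzero I,
   the right-hand side because I^2 = -1 *)
transitivity (T1 * A2 * A3 * x ^+ 3 / (e1 * y * w * t2 * t3) -
  Q ^+ 3 * A23 * x / (e1 * y * w * t2 * t3 * I ^+ 2)).
  by field; rewrite ?T2 ?T3 ?T23 ?ne1 ?nx ?ny ?nw ?i0.
rewrite i2; field; by rewrite ?T2 ?T3 ?T23 ?ne1 ?nx ?ny ?nw ?i0.
Qed.

(** * Continuity of F *)

Lemma cvg_e2pi (W : Type) (F : set_system W) (FF : Filter F) (f : W -> C) (l : C) :
  (f w @[w --> F] --> l) -> (e2pi (f w) @[w --> F] --> e2pi l).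
Proof.
move=> /cvg_Re_Im[hr hi].
have he : expR (- (2 * pi * complex.Im (f w))) @[w --> F] --> expR (- (2 * pi * complex.Im l)).
  apply: continuous_cvg; first exact: continuous_expR.
  by apply: cvgN; apply: cvgM => //; exact: cvg_cst.
have ha : 2 * pi * complex.Re (f w) @[w --> F] --> 2 * pi * complex.Re l.
  by apply: cvgM => //; exact: cvg_cst.
have hc : cos (2 * pi * complex.Re (f w)) @[w --> F] --> cos (2 * pi * complex.Re l).
  by apply: continuous_cvg ha; exact: continuous_cos.
have hs : sin (2 * pi * complex.Re (f w)) @[w --> F] --> sin (2 * pi * complex.Re l).
  by apply: continuous_cvg ha; exact: continuous_sin.
have ReE (z : C) : complex.Re (e2pi z) =
    expR (- (2 * pi * complex.Im z)) * cos (2 * pi * complex.Re z).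
  by rewrite e2pi_polar /= mul0r subr0.
have ImE (z : C) : complex.Im (e2pi z) =
    expR (- (2 * pi * complex.Im z)) * sin (2 * pi * complex.Re z).
  by rewrite e2pi_polar /= mul0r addr0.
apply/cvg_Re_Im; split.
  rewrite ReE; under eq_fun do rewrite ReE; exact: cvgM.
rewrite ImE; under eq_fun do rewrite ImE; exact: cvgM.
Qed.

Section AtPoint.
Variables z1 z2 z3 : C.
Hypothesis hz2 : 0 < complex.Im z2 < t.
Hypothesis hz3 : 0 < complex.Im z3 < t.
Local Notation p := ((z1, z2, z3) : C * C * C).

Lemma cvg_coord1 : (w : C * C * C).1.1 @[w --> nbhs p] --> z1.
Proof. by apply: cvg_comp; [exact: cvg_fst|exact: cvg_fst]. Qed.

Lemma cvg_coord2 : (w : C * C * C).1.2 @[w --> nbhs p] --> z2.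
Proof. by apply: cvg_comp; [exact: cvg_fst|exact: cvg_snd]. Qed.

Lemma cvg_coord3 : (w : C * C * C).2 @[w --> nbhs p] --> z3.
Proof. exact: cvg_snd. Qed.

Lemma cvg_triple_term i : triple_term tau w.1.1 w.1.2 w.2 i @[w --> nbhs p] --> triple_term tau z1 z2 z3 i.
Proof.
case: i => [[k l] m]; rewrite triple_termE; under eq_fun do rewrite triple_termE.
have c1 := cvg_e2pi _ (cvgM (cvg_cst (k%:~R : C)) cvg_coord1).
have c2 := cvg_e2pi _ (cvgM (cvg_cst (l%:~R : C)) cvg_coord2).
have c3 := cvg_e2pi _ (cvgM (cvg_cst (m%:~R : C)) cvg_coord3).
apply: cvgM; first exact: cvg_cst.
apply: cvgM; last exact: cvg_cst.
apply: cvgM; last exact: c3.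
apply: cvgM; last exact: c2.
apply: cvgM; first exact: cvg_cst.
exact: c1.
Qed.

(** A radius within which the second and third coordinates stay in the strip, at a
    distance from its boundary that is bounded below. *)
Definition margin : R := Num.min 1
  (Num.min (Num.min (complex.Im z2) (t - complex.Im z2))
           (Num.min (complex.Im z3) (t - complex.Im z3)) / 2).

Lemma margin_gt0 : 0 < margin.
Proof.
case/andP: hz2 => h1 h2; case/andP: hz3 => h3 h4.
by rewrite lt_min ltr01 divr_gt0 // !lt_min h1 h3 !subr_gt0 h2.
Qed.

Lemma margin_le (z : C) : 2 * margin <= Num.min (complex.Im z) (t - complex.Im z) ->
  forall w, cabs (w - z) < margin ->
  margin <= Num.min (complex.Im w) (t - complex.Im w).
Proof.
rewrite !le_min => /andP[h1 h2] w hw; have := abs_Im_le (w - z).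
rewrite ImD ImN ler_norml le_min => /andP[h3 h4]; apply/andP; split; lra.
Qed.

Lemma margin_le2 : 2 * margin <= Num.min (complex.Im z2) (t - complex.Im z2) /\
  2 * margin <= Num.min (complex.Im z3) (t - complex.Im z3).
Proof.
set a := Num.min (complex.Im z2) _; set b := Num.min (complex.Im z3) _.
have h : margin <= Num.min a b / 2 by rewrite /margin ge_min lexx orbT.
have h1 : Num.min a b <= a by rewrite ge_min lexx.
have h2 : Num.min a b <= b by rewrite ge_min lexx orbT.
split; lra.
Qed.

Lemma near_point : \forall w \near nbhs p,
  [/\ cabs (w.1.1 - z1) < 1, cabs (w.1.2 - z2) < margin & cabs (w.2 - z3) < margin].
Proof.
move/cvg_cabsP: cvg_coord1 => /(_ 1 ltr01) h1.
move/cvg_cabsP: cvg_coord2 => /(_ _ margin_gt0) h2.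
move/cvg_cabsP: cvg_coord3 => /(_ _ margin_gt0) h3.
by move: h1 h2 h3; apply: filterS3.
Qed.

Lemma margin_strip (y : C) : margin <= Num.min (complex.Im y) (t - complex.Im y) ->
  0 < complex.Im y < t.
Proof.
have m0 := margin_gt0; rewrite le_min => /andP[h1 h2]; apply/andP; split; lra.
Qed.

(** The modulus of x^k is largest at one of the two ends of the allowed range of
    Im z1, depending on the sign of k; adding both ends covers all k. *)
Definition triple_term_bound (i : int * int * int) : R :=
  rho tau (-1) * ((cabs (theta_coef tau i.1.1 * e2pi (i.1.1%:~R * (z1 + 'i%C))) +
    cabs (theta_coef tau i.1.1 * e2pi (i.1.1%:~R * (z1 - 'i%C)))) *
  expR (- (P * margin * `|i.1.2|%:~R)) * expR (- (P * margin * `|i.2|%:~R))).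

Lemma absum_triple_term_bound : absum triple_term_bound.
Proof.
have d0 : 0 < P * margin by rewrite mulr_gt0 ?margin_gt0 // two_pi_gt0.
have he := absum_expR_abs d0.
have e0 (l : int) : 0 <= expR (- (P * margin * `|l|%:~R)) by exact: expR_ge0.
have ha := absumD (absum_theta htau (z1 + 'i%C)) (absum_theta htau (z1 - 'i%C)).
have a0 (k : int) : 0 <= cabs (theta_coef tau k * e2pi (k%:~R * (z1 + 'i%C))) +
    cabs (theta_coef tau k * e2pi (k%:~R * (z1 - 'i%C))) by rewrite addr_ge0 ?cabs_ge0.
have h1 := absum_prod a0 e0 ha he.
have b0 (p : int * int) := mulr_ge0 (a0 p.1) (e0 p.2).
exact: absumZ (ltW (rho_gt0 tau (-1))) (absum_prod b0 e0 h1 he).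
Qed.

Lemma triple_term_le_bound (x y w : C) i : cabs (x - z1) < 1 ->
  margin <= Num.min (complex.Im y) (t - complex.Im y) ->
  margin <= Num.min (complex.Im w) (t - complex.Im w) ->
  cabs (triple_term tau x y w i) <= triple_term_bound i.
Proof.
move=> hx hy hw; case: i => [[k l] m].
have sy := margin_strip hy; have sw := margin_strip hw.
apply: (le_trans (cabs_triple_term_le htau x sy sw k l m)).
rewrite ler_wpM2l ?(ltW (rho_gt0 _ _)) //=.
have dec (z : C) (n : int) : margin <= Num.min (complex.Im z) (t - complex.Im z) ->
    decay tau z n <= expR (- (P * margin * `|n|%:~R)).
  move=> h; rewrite ler_expR lerN2 ler_wpM2r ?ler0z //.
  by rewrite ler_wpM2l ?(ltW (two_pi_gt0 R)).
apply: ler_pM; rewrite ?mulr_ge0 ?cabs_ge0 ?decay_ge0 ?dec //.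
apply: ler_pM; rewrite ?mulr_ge0 ?cabs_ge0 ?decay_ge0 ?dec //.
rewrite !cabsM -mulrDr ler_wpM2l ?cabs_ge0 //.
have := abs_Im_le (x - z1); rewrite ImD ImN ler_norml => /andP[h1 h2].
rewrite !cabs_e2pi !Im_intM !ImD ImN /=.
have [k0|k0] := leP 0 k.
  apply: ler_wpDl; first exact: expR_ge0.
  rewrite ler_expR lerN2 ler_wpM2l ?(ltW (two_pi_gt0 R)) // ler_wpM2l ?ler0z //; lra.
apply: ler_wpDr; first exact: expR_ge0.
rewrite ler_expR lerN2 ler_wpM2l ?(ltW (two_pi_gt0 R)) //.
have : (k%:~R : R) <= 0 by rewrite -[0]/(0%:~R) ler_int ltW.
nra.
Qed.

Lemma F_cvg : (F w.1.1 w.1.2 w.2 tau : C) @[w --> nbhs p] --> F z1 z2 z3 tau.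
Proof.
have [m2 m3] := margin_le2; have mg := margin_gt0.
have hS : triple_sum tau w.1.1 w.1.2 w.2 @[w --> nbhs p] --> triple_sum tau z1 z2 z3.
  apply/cvg_cabsP; apply: (@has_sum_dominated R _ (nbhs p) _ _
    (fun (w : C * C * C) i => triple_term tau w.1.1 w.1.2 w.2 i) (triple_term tau z1 z2 z3) _ _
    triple_term_bound absum_triple_term_bound).
  - move: near_point; apply: filterS => w [h1 h2 h3] i; apply: triple_term_le_bound => //.
      exact: margin_le m2 _ h2.
    exact: margin_le m3 _ h3.
  - move=> i; apply: triple_term_le_bound; rewrite ?subrr ?cabs0 //; lra.
  - by move=> i; apply/cvg_cabsP; exact: cvg_triple_term.
  - move: near_point; apply: filterS => w [h1 h2 h3].
    apply: absum_sum; apply: absum_triple_term => //; apply: margin_strip.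
      exact: margin_le m2 _ h2.
    exact: margin_le m3 _ h3.
  - exact/absum_sum/absum_triple_term.
have hpre : e2pi (- (tau / 8) - w.1.1 / 2 + w.1.2 / 2 + w.2 / 2) @[w --> nbhs p] -->
    e2pi (- (tau / 8) - z1 / 2 + z2 / 2 + z3 / 2).
  apply: cvg_e2pi.
  apply: cvgD; last by apply: cvgM; [exact: cvg_coord3|exact: cvg_cst].
  apply: cvgD; last by apply: cvgM; [exact: cvg_coord2|exact: cvg_cst].
  apply: cvgB; first exact: cvg_cst.
  by apply: cvgM; [exact: cvg_coord1|exact: cvg_cst].
rewrite (F_triple_sum z1 hz2 hz3).
apply: (@cvg_trans _ ((e2pi (- (tau / 8) - w.1.1 / 2 + w.1.2 / 2 + w.2 / 2) *
   triple_sum tau w.1.1 w.1.2 w.2) @[w --> nbhs p])); last first.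
  exact: cvgM hpre hS.
apply: near_eq_cvg; move: near_point; apply: filterS => w [h1 h2 h3].
rewrite (F_triple_sum w.1.1 (z2 := w.1.2) (z3 := w.2)) //; apply: margin_strip.
  exact: margin_le m2 _ h2.
exact: margin_le m3 _ h3.
Qed.

End AtPoint.

(** * Density of the domain, and the theorem *)

(** The imaginary part of a lattice point is an integer multiple of Im tau, so a
    small vertical displacement leaves the lattice. *)
Lemma near_nonlattice (z : C) : \forall e \near (0 : R)^'+, ~ lattice tau (z + e%:C%C * 'i%C).
Proof.
set a := complex.Im z / t; pose n := Num.floor a.
have h1 : n%:~R <= a by exact: floor_le_tmp.
have h2 : a < n%:~R + 1 by rewrite -[1]/(1%:~R) -intrD floorD1_gt.
have d0 : 0 < (n%:~R + 1 - a) * t by rewrite mulr_gt0 // subr_gt0.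
near=> e => -[m [k hmk]].
have e0 : 0 < e by near: e; exact: nbhs_right_gt.
have e1 : e < (n%:~R + 1 - a) * t by near: e; exact: nbhs_right_lt.
have : complex.Im (z + e%:C%C * 'i%C) = m%:~R * t.
  rewrite hmk ImD Im_intM -[k%:~R]mulr1 Im_intM /=; ring.
have -> : complex.Im (z + e%:C%C * 'i%C) = a * t + e.
  by rewrite ImD Im_realM /= mulr1 /a divfK // gt_eqF.
move=> h.
have m1 : (n < m)%R by rewrite -(ltr_int R); nra.
have m2 : (m < n + 1)%R by rewrite -(ltr_int R) rmorphD /=; nra.
lia.
Unshelve. all: by end_near. Qed.

Lemma strip_nonlattice (z : C) : 0 < complex.Im z < t -> ~ lattice tau z.
Proof.
move=> h [m [k e]]; have /eqP := strip_neq1 htau h (- m); apply.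
by rewrite e rmorphN mulNr addrAC subrr add0r e2pi_int.
Qed.

Lemma dom_closure (z1 z2 z3 : C) : 0 < complex.Im z2 < t -> 0 < complex.Im z3 < t ->
  closure (F_rhs_dom tau) ((z1, z2, z3) : C * C * C).
Proof.
move=> h2 h3 B hB.
pose g (e : R) : C * C * C := (z1 + e%:C%C * 'i%C, z2 + e%:C%C * 'i%C, z3).
have cz (z : C) : (z + e%:C%C * 'i%C) @[e --> (0 : R)^'+] --> z.
  apply/cvg_cabsP => d d0; near=> e.
  have e0 : 0 < e by near: e; exact: nbhs_right_gt.
  rewrite addrAC subrr add0r cabsM cabs_real gtr0_norm //.
  by rewrite cabs_i mulr1; near: e; exact: nbhs_right_lt.
have hg : g e @[e --> (0 : R)^'+] --> ((z1, z2, z3) : C * C * C).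
  exact: (cvg_pair (cvg_pair (cz z1) (cz z2)) (cvg_cst z3)).
have hB' : \forall e \near (0 : R)^'+, B (g e) by exact: hg.
have n1 := near_nonlattice z1; have n23 := near_nonlattice (z2 + z3).
have n2 := near_nonlattice z2.
have hh : \forall e \near (0 : R)^'+, (B (g e) /\ ~ lattice tau (z1 + e%:C%C * 'i%C)) /\
    (~ lattice tau (z2 + e%:C%C * 'i%C) /\ ~ lattice tau (z2 + z3 + e%:C%C * 'i%C)).
  by apply: filterI; apply: filterI.
have [e [[b1 b2] [b3 b4]]] := @filter_ex _ _ (at_right_proper_filter (0 : R)) _ hh.
exists (g e); split=> //.
split=> //=; first exact: strip_nonlattice.
by rewrite addrAC.
Unshelve. all: by end_near. Qed.

End Classical.

Theorem theorem1p3 (R : realType) (tau : cplx R) (htau : 0 < complex.Im tau)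
    (z1 z2 z3 : cplx R)
    (hz2 : 0 < complex.Im z2 < complex.Im tau)
    (hz3 : 0 < complex.Im z3 < complex.Im tau) :
  continued_value (F_rhs_dom tau) (F_rhs tau) (z1, z2, z3) (F z1 z2 z3 tau).
Proof.
split.
- exact: dom_closure.
- exact: F_eq_rhs.
have hF := F_cvg htau (z1 := z1) hz2 hz3.
have [m2 m3] := margin_le2 tau z2 z3.
have hn := near_point z1 hz2 hz3.
apply: cvg_trans (cvg_trans (cvg_app _ (cvg_within _)) hF).
apply: near_eq_cvg; rewrite near_withinE.
move: hn; apply: filterS => -[[w1 w2] w3] [_ h2 h3] hD.
rewrite F_eq_rhs //; apply: (margin_strip hz2 hz3).
  exact: margin_le m2 _ h2.
exact: margin_le m3 _ h3.
Qed.
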